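(* Let $N\in\mathbb N$ and assume that $P_1,\dots,P_N\in\mathcal P_{\le N}$ are independent. Then, for any $s=1,\dots,N$, there exists an $N$-rigidity subgroup $G\subset\mathcal P_{\le N}$ containing $P_1,\dots,P_s$ and such that $P_{s+1},\dots,P_N\notin G$. That is, there exist a unitary operator $U\in\mathcal U(\mathcal H)$ on a nonzero Hilbert space $\mathcal H$ and an idempotent $p\in\beta\mathbb N$ such that $p\text{-}\lim_{n\in\mathbb N}U^{P_i(n)}=Id$ for $i=1,\dots,s$ and $p\text{-}\lim_{n\in\mathbb N}U^{P_i(n)}=0$ for $i=s+1,\dots,N$.
   Context: $\mathbb N=\{1,2,\dots\}$. $\mathcal P_{\le N}$ is the additive group of polynomials $P\in\mathbb Z[x]$ with $P(0)=0$ and $\deg P\le N$. Polynomials $P_1,\dots,P_m$ are independent if $\sum_{i=1}^m n_iP_i=0$ with $n_i\in\mathbb Z$ implies $n_1=\dots=n_m=0$. $\beta\mathbb N$ is the set of ultrafilters on $\mathbb N$, with addition defined by: $A\in p+q$ iff $\{n\in\mathbb N: A-n\in p\}\in q$, where $A-n=\{y\in\mathbb N: y+n\in A\}$; $p$ is idempotent if $p+p=p$. For a sequence $(x_n)$ in a topological space, $p\text{-}\lim_{n\in\mathbb N}x_n=x$ means that $\{n\in\mathbb N: x_n\in O\}\in p$ for every open neighbourhood $O$ of $x$; for bounded operators on a Hilbert space, $p$-limits are taken in the weak operator topology. Hilbert spaces are complex and separable; $\mathcal U(\mathcal H)$ is the group of unitary operators on $\mathcal H$. A subgroup $G\subset\mathcal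 P_{\le N}$ is called an $N$-rigidity group if there exist an idempotent $p\in\beta\mathbb N$ and a unitary operator $U$ on a (nonzero) Hilbert space $\mathcal H$ such that $G=\{P\in\mathcal P_{\le N}: p\text{-}\lim_{n\in\mathbb N}U^{P(n)}=Id\}$ and $p\text{-}\lim_{n\in\mathbb N}U^{Q(n)}=0$ for each $Q\in\mathcal P_{\le N}\setminus G$. *)

(* Defs.v *)
From HB Require Import structures.
From mathcomp Require Import all_boot all_order all_algebra.
From mathcomp Require Import complex.
From mathcomp Require Import all_classical all_reals.
From mathcomp Require Import topology normedtype.

Set Implicit Arguments.
Unset Strict Implicit.
Unset Printing Implicit Defensive.

Import Order.TTheory GRing.Theory Num.Theory.
Import numFieldNormedType.Exports.

Local Open Scope classical_set_scope.
Local Open Scope ring_scope.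
Local Open Scope complex_scope.

(* The semigroup N = {1, 2, ...}. Zero has to be excluded: the principal
   ultrafilter at 0 would be an idempotent. *)
Definition posnat := {n : nat | (0 < n)%N}.

Definition posnat_add (m n : posnat) : posnat :=
  exist _ (val m + val n)%N (ltn_addr (val n) (valP m)).

(* A \in p + q iff {n | A - n \in p} \in q, with A - n = {y | y + n \in A}. *)
Definition ultra_add (p q : set_system posnat) : set_system posnat :=
  [set A | q [set n | p [set y | A (posnat_add y n)]]].

Definition idempotent_ultrafilter (p : set_system posnat) : Prop :=
  UltraFilter p /\ ultra_add p p = p.

Record hilbertSpace (R : realType) := HilbertSpace {
  hilbert_sort :> completeNormedModType R[i];
  hdot : {dot hilbert_sort for Num.conj};
  hdot_norm : forall x : hilbert_sort, `|x| ^+ 2 = hdot x x;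
  hilbert_separable : exists2 D : set hilbert_sort, countable D & dense D
}.

Section Operators.
Variables (R : realType) (H : hilbertSpace R).

Record boundedOp := BoundedOp {
  bop_fun :> {linear H -> H};
  bop_bounded : exists M : R[i], forall x : H, `|bop_fun x| <= M * `|x|
}.

HB.instance Definition _ := gen_eqMixin boundedOp.
HB.instance Definition _ := gen_choiceMixin boundedOp.

Lemma bop_zero_bounded :
  exists M : R[i], forall x : H, `|(\0%R : {linear H -> H}) x| <= M * `|x|.
Proof. by exists 0 => x /=; rewrite normr0 mul0r. Qed.

Definition bop_zero : boundedOp := BoundedOp bop_zero_bounded.

Lemma bop_id_bounded :
  exists M : R[i], forall x : H, `|(idfun : {linear H -> H}) x| <= M * `|x|.
Proof. by exists 1 => x /=; rewrite mul1r. Qed.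

Definition bop_id : boundedOp := BoundedOp bop_id_bounded.

Lemma bop_comp_bounded (S T : boundedOp) :
  exists M : R[i], forall x : H, `|(S \o T : {linear H -> H}) x| <= M * `|x|.
Proof.
have [M1 h1] := bop_bounded S; have [M2 h2] := bop_bounded T.
exists (`|M1| * `|M2|) => x /=.
have [-> | x0] := eqVneq x 0; first by rewrite !raddf0 normr0 mulr0.
have nx : 0 < `|x| by rewrite normr_gt0.
have M2ge : 0 <= M2.
  by rewrite -(pmulr_lge0 _ nx) (le_trans _ (h2 x)).
have [y0|y0] := eqVneq (T x) 0.
  by rewrite y0 raddf0 normr0 !mulr_ge0.
have ny : 0 < `|T x| by rewrite normr_gt0.
have M1ge : 0 <= M1.
  by rewrite -(pmulr_lge0 _ ny) (le_trans _ (h1 (T x))).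
rewrite !ger0_norm // -mulrA (le_trans (h1 _)) //.
by rewrite ler_wpM2l.
Qed.

Definition bop_comp (S T : boundedOp) : boundedOp :=
  BoundedOp (bop_comp_bounded S T).

(* The weak operator topology on the bounded operators: the coarsest topology
   making every T |-> <T x, y> continuous. The norm topology of the complex
   numbers is carried by the alias R[i]^o. *)
Definition matrix_coefs (T : boundedOp) : {ptws H * H -> R[i]^o} :=
  fun xy => hdot H (T xy.1) xy.2.

Definition wot := initial_topology matrix_coefs.

Definition wot_plim (p : set_system posnat) (T : posnat -> boundedOp)
  (S : boundedOp) : Prop := (T : posnat -> wot) @ p --> (S : wot).

Record unitaryOp := UnitaryOp {
  unitary_op :> boundedOp;
  unitary_adj : boundedOp;
  unitary_adjP : forall x y : H,
    hdot H (unitary_op x) y = hdot H x (unitary_adj y);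
  unitaryK : cancel unitary_op unitary_adj;
  unitary_adjK : cancel unitary_adj unitary_op
}.

Definition unitary_zpow (U : unitaryOp) (k : int) : boundedOp :=
  match k with
  | Posz n => iter n (bop_comp U) bop_id
  | Negz n => iter n.+1 (bop_comp (unitary_adj U)) bop_id
  end.

Definition unitary_poly_pow (U : unitaryOp) (P : {poly int}) (n : posnat) :
  boundedOp := unitary_zpow U P.[(val n)%:Z].

End Operators.

Definition polyN (N : nat) : set {poly int} :=
  [set P | P.[0] = 0 /\ (size P <= N.+1)%N].

Definition poly_independent (m : nat) (P : 'I_m -> {poly int}) : Prop :=
  forall c : 'I_m -> int,
    \sum_(i < m) c i *: P i = 0 -> forall i, c i = 0.

Definition subgroup_polyN (N : nat) (G : set {poly int}) : Prop :=
  G `<=` polyN N /\ zmod_closed [in G].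

Definition rigidity_group (R : realType) (N : nat) (G : set {poly int}) :
    Prop :=
  subgroup_polyN N G /\
  exists (H : hilbertSpace R) (U : unitaryOp H) (p : set_system posnat),
    [/\ exists x : H, x != 0,
        idempotent_ultrafilter p,
        G = [set P | polyN N P /\
                     wot_plim p (unitary_poly_pow U P) (bop_id H)]
      & forall Q : {poly int}, (polyN N `\` G) Q ->
          wot_plim p (unitary_poly_pow U Q) (bop_zero H)].

(* Main.v *)
Require Import Defs.
From Stdlib Require PeanoNat.
From HB Require Import structures.
From mathcomp Require Import all_boot all_order all_algebra.
From mathcomp Require Import complex.
From mathcomp Require Import all_classical all_reals.
From mathcomp Require Import topology normedtype sequences derive trigo.
From mathcomp Require Import ring lra zify.
Import Order.TTheory GRing.Theory Num.Theory.
Import numFieldNormedType.Exports.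
Set Implicit Arguments.
Unset Strict Implicit.
Unset Printing Implicit Defensive.
Local Open Scope classical_set_scope.
Local Open Scope ring_scope.
Local Open Scope complex_scope.

(** Why the theorem holds.  The group G is taken to be the kernel of a character
of finite order: integers c_1, ..., c_N and M > 0 are chosen so that the linear
form weight Q = sum_d c_d Q_d vanishes modulo M on P_1, ..., P_s and equals M/2
modulo M on the other P_i (separating_weights, by Cramer's rule).  A subgroup of
infinite index would not do in general: if, say, the square x^2 is in G, then
idempotence of p, applied to (x + m)^2 = x^2 + 2mx + m^2, forces 2mx to be in G
for p-many m.

Formally U is the operator exp (2 i pi sum_j tau_j E_j) for a commuting family
of orthogonal projections E_j and a summable sequence of angles tau_j.  Such
operators multiply by adding their angles, and they move little in norm when the
angles move little modulo 1 (phase_limD, phase_lim_int, phase_lim_le).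

The angles are matched with a rapidly growing sequence n_j of multiples of M:
tau_j = sum_d c_d / (M n_j^d), so that n_j^d tau_j is c_d / M modulo 1 up to
O(1/n_j), for all d at once.  Each n_j is also divisible by the denominators of
the earlier angles and is much larger than powers of the earlier terms.  Hence,
for a finite set of indices alpha contained in [J, oo) and the sum n_alpha of
the n_j over alpha, and for every Q in P_{<=N}, the number Q(n_alpha) tau_j is,
modulo 1, weight Q / M if j is in alpha and 0 otherwise, up to errors whose sum
over j is O(2^-J) (horner_ipsum).  Therefore U^{Q(n_alpha)} is close in norm to
the product over j in alpha of 1 + (w - 1) E_j, where w = exp (2 i pi weight Q / M).

If M divides weight Q, then w = 1 and this product is the identity.  If not, the
projections are chosen so that the product tends weakly to 0: the Hilbert space
is l^2(N), E_j = (1 - Z_j) / 2, and Z_j is the permutation of the basis that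
flips the j-th binary digit.  On vectors supported in [0, 2^J), each factor
1 + (w - 1) E_j = (1 + w)/2 + (1 - w)/2 Z_j contributes (1 + w)/2 to the matrix
coefficients, because Z_j moves [0, 2^j) off itself.  As |(1 + w)/2| < 1, the
coefficients are small when alpha has many elements (block_phase_weak).

The sets of all n_alpha with alpha contained in [J, oo) and of cardinality at
least J generate a filter F contained in F + F, and Ellis's argument gives an
idempotent ultrafilter p that contains F (idempotent_extending).  Along p,
U^{Q(n)} tends to the identity for Q in G and to 0 for the other Q. *)

(** * The Hilbert space of square-summable sequences *)

Section RealParts.
Variable R : realType.
Local Notation C := R[i].
Implicit Types z w : C.

(** The real part of z times the conjugate of w.  Working with real parts keeps all
series real; the imaginary part of the inner product is recovered in dotC. *)
Definition rdot z w : R := complex.Re z * complex.Re w + complex.Im z * complex.Im w.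

Lemma rdotC z w : rdot z w = rdot w z.
Proof. by rewrite /rdot; ring. Qed.

Lemma rdotDl z1 z2 w : rdot (z1 + z2) w = rdot z1 w + rdot z2 w.
Proof. by case: z1 z2 w => [a b] [c d] [e f]; rewrite /rdot /=; ring. Qed.

Lemma rdotZl (a : R) z w : rdot (a%:C * z) w = a * rdot z w.
Proof. by case: z w => [b c] [d e]; rewrite /rdot /=; ring. Qed.

Lemma rdotii z w : rdot ('i * z) ('i * w) = rdot z w.
Proof. by case: z w => [b c] [d e]; rewrite /rdot /=; ring. Qed.

Lemma rdotiN z w : rdot ('i * z) w = - rdot z ('i * w).
Proof. by case: z w => [b c] [d e]; rewrite /rdot /=; ring. Qed.

Lemma rdot_ge0 z : 0 <= rdot z z.
Proof. by rewrite /rdot addr_ge0 // -expr2 sqr_ge0. Qed.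

Lemma rdot_eq0 z : rdot z z = 0 -> z = 0.
Proof.
case: z => a b; rewrite /rdot /= => /eqP.
rewrite paddr_eq0 -?expr2 ?sqr_ge0 // !sqrf_eq0 => /andP[/eqP-> /eqP->] //.
Qed.

Lemma rdot0l w : rdot 0 w = 0.
Proof. by rewrite /rdot !mul0r addr0. Qed.

Lemma rdot0r w : rdot w 0 = 0.
Proof. by rewrite rdotC rdot0l. Qed.

Lemma rdot_normN z : rdot (- z) (- z) = rdot z z.
Proof. by case: z => a b; rewrite /rdot /= !mulrNN. Qed.

Lemma rdot_normM (a z : C) : rdot (a * z) (a * z) = rdot a a * rdot z z.
Proof. by case: a z => [a b] [c d]; rewrite /rdot /=; ring. Qed.

Lemma rdot_normD z w : rdot (z + w) (z + w) <= 2 * rdot z z + 2 * rdot w w.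
Proof.
case: z w => [a b] [c d]; rewrite /rdot /=.
by have := sqr_ge0 (a - c); have := sqr_ge0 (b - d); nra.
Qed.

Lemma ler_rdot z w : `|rdot z w| <= rdot z z + rdot w w.
Proof.
case: z w => [a b] [c d]; rewrite /rdot /= ler_norml.
have := (sqr_ge0 (a - c), sqr_ge0 (b - d), sqr_ge0 (a + c), sqr_ge0 (b + d)).
by move=> [[[h1 h2] h3] h4]; apply/andP; split; nra.
Qed.

End RealParts.

Section SquareSummable.
Variable R : realType.
Local Notation C := R[i].

(** Bounded partial sums rather than a convergent series: closure under linear
combinations is then a termwise estimate. *)
Definition sqsummable : {pred nat -> C} :=
  [pred f : nat -> C | `[< exists B : R, forall n, \sum_(k < n) rdot (f k) (f k) <= B >]].

Lemma sqsummable_submod : GRing.submod_closed sqsummable.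
Proof.
split=> [|a f g /asboolP[Bf hf] /asboolP[Bg hg]]; apply/asboolP.
  by exists 0 => n; rewrite big1 // => k _; rewrite rdot0l.
exists (2 * (rdot a a * Bf) + 2 * Bg) => n.
apply: (@le_trans _ _ (\sum_(k < n) (2 * (rdot a a * rdot (f k) (f k))
    + 2 * rdot (g k) (g k)))).
  by apply: ler_sum => k _; rewrite -rdot_normM; apply: rdot_normD.
rewrite big_split /= -!mulr_sumr lerD // ler_pM2l // ?hg //.
by rewrite ler_wpM2l ?rdot_ge0 ?hf.
Qed.

HB.instance Definition _ :=
  GRing.isSubmodClosed.Build C (nat -> C) sqsummable sqsummable_submod.

Record ell2 := Ell2 { ell2_fun :> nat -> C; ell2P : ell2_fun \in sqsummable }.

HB.instance Definition _ := [isSub for ell2_fun].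
HB.instance Definition _ := [Choice of ell2 by <:].
HB.instance Definition _ := [SubChoice_isSubLmodule of ell2 by <:].

Implicit Types f g h : ell2.

Lemma ell2DE (f g : ell2) k : (f + g) k = f k + g k. Proof. by []. Qed.
Lemma ell2NE (f : ell2) k : (- f) k = - f k. Proof. by []. Qed.
Lemma ell2BE (f g : ell2) k : (f - g) k = f k - g k. Proof. by []. Qed.
Lemma ell2ZE a (f : ell2) k : (a *: f) k = a * f k. Proof. by []. Qed.
Lemma ell2_inj (f g : ell2) : f =1 g -> f = g.
Proof. by move=> fg; apply: val_inj; apply/funext. Qed.

Definition ip (f g : ell2) : R := limn (series (fun k => rdot (f k) (g k))).

Lemma sqsum_bound (f : ell2) :
  exists B : R, forall n, \sum_(k < n) rdot (f k) (f k) <= B.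
Proof. by have /asboolP := ell2P f. Qed.

Lemma sq_cvg (f : ell2) : cvgn (series (fun k => rdot (f k) (f k))).
Proof.
have [B hB] := sqsum_bound f.
apply: nondecreasing_is_cvgn.
  by apply/nondecreasing_seqP => n; rewrite seriesSr lerDl rdot_ge0.
by exists B => _ [n _ <-]; rewrite /series /= big_mkord.
Qed.

Lemma ip_cvg (f g : ell2) : cvgn (series (fun k => rdot (f k) (g k))).
Proof.
apply: normed_cvg.
apply: (@series_le_cvg _ _ (fun k => rdot (f k) (f k) + rdot (g k) (g k))).
- by move=> n /=.
- by move=> n; rewrite addr_ge0 ?rdot_ge0.
- by move=> n; apply: ler_rdot.
by apply: is_cvg_seriesD; apply: sq_cvg.
Qed.

Lemma ipC f g : ip f g = ip g f.
Proof.
rewrite /ip (_ : (fun k => _) = fun k => rdot (g k) (f k)) //.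
by apply/funext => k; rewrite rdotC.
Qed.

Lemma ipDl f g h : ip (f + g) h = ip f h + ip g h.
Proof.
rewrite /ip -lim_seriesD; [|exact: ip_cvg..].
rewrite (_ : (fun k => _) =
  (fun k => rdot (f k) (h k)) + (fun k => rdot (g k) (h k))) //.
by apply/funext => k; rewrite ell2DE rdotDl.
Qed.

Lemma ipZl (a : R) f g : ip (a%:C *: f) g = a * ip f g.
Proof.
transitivity (a *: ip f g) => //.
rewrite /ip -lim_seriesZ; last exact: ip_cvg.
rewrite (_ : (fun k => _) = a *: (fun k => rdot (f k) (g k))) //.
by apply/funext => k; rewrite ell2ZE rdotZl.
Qed.

Lemma ipii f g : ip ('i *: f) ('i *: g) = ip f g.
Proof.
rewrite /ip (_ : (fun k => _) = fun k => rdot (f k) (g k)) //.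
by apply/funext => k; rewrite !ell2ZE rdotii.
Qed.

Lemma ipiN f g : ip ('i *: f) g = - ip f ('i *: g).
Proof.
rewrite /ip -lim_seriesN; last exact: ip_cvg.
rewrite (_ : (fun k => _) = - (fun k => rdot (f k) (('i *: g : ell2) k))) //.
by apply/funext => k; rewrite ell2ZE rdotiN.
Qed.

Lemma ipDr f g h : ip h (f + g) = ip h f + ip h g.
Proof. by rewrite ipC ipDl !(ipC h). Qed.
Lemma ipZr (a : R) f g : ip f (a%:C *: g) = a * ip f g.
Proof. by rewrite ipC ipZl ipC. Qed.

Lemma ip_series_le f n : \sum_(k < n) rdot (f k) (f k) <= ip f f.
Proof.
rewrite -(big_mkord xpredT (fun k => rdot (f k) (f k))).
apply: (nondecreasing_cvgn_le (u_ := series _)); last exact: sq_cvg.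
by apply/nondecreasing_seqP => m; rewrite seriesSr lerDl rdot_ge0.
Qed.

Lemma ip_ge0 f : 0 <= ip f f.
Proof. by apply: le_trans (ip_series_le f 0); rewrite big_ord0. Qed.

Lemma coord_le_ip (f : ell2) k : rdot (f k) (f k) <= ip f f.
Proof.
apply: le_trans (ip_series_le f k.+1); rewrite big_ord_recr /= lerDr.
by apply: sumr_ge0 => i _; apply: rdot_ge0.
Qed.

Lemma ip_eq0 f : ip f f = 0 -> f = 0.
Proof.
move=> f0; apply: ell2_inj => k; apply: rdot_eq0.
by apply/eqP; rewrite eq_le rdot_ge0 andbT -f0 coord_le_ip.
Qed.

Lemma ip_le (f : ell2) B :
  (forall n, \sum_(k < n) rdot (f k) (f k) <= B) -> ip f f <= B.
Proof.
move=> hB; apply: limr_le; first exact: ip_cvg.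
by near=> n; rewrite /series /= big_mkord.
Unshelve. all: by end_near. Qed.

(** Positivity of ip on the vector ip g g f - ip f g g. *)
Lemma ip_CS f g : ip f g ^+ 2 <= ip f f * ip g g.
Proof.
have [g0|gn0] := eqVneq (ip g g) 0.
  rewrite (ip_eq0 g0) -[X in ip f X](scaler0 _ (0 : R)%:C) ipZr.
  by rewrite mul0r expr2 mul0r mulr_ge0 ?ip_ge0.
have gp : 0 < ip g g by rewrite lt_def gn0 ip_ge0.
have := ip_ge0 ((ip g g)%:C *: f + (- ip f g)%:C *: g).
rewrite ipDl !ipDr !ipZl !ipZr (ipC g f).
set a := ip f f; set b := ip f g; set c := ip g g in gp *.
move=> h; have {h} : 0 <= c * (a * c - b ^+ 2) by move: h; congr (_ <= _); ring.
by rewrite pmulr_rge0 // subr_ge0.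
Qed.

Definition l2norm f : R := Num.sqrt (ip f f).

Lemma l2norm_sqr f : l2norm f ^+ 2 = ip f f.
Proof. by rewrite sqr_sqrtr // ip_ge0. Qed.

Lemma l2norm_ge0 f : 0 <= l2norm f. Proof. exact: sqrtr_ge0. Qed.

Lemma ip_le_norm f g : ip f g <= l2norm f * l2norm g.
Proof.
have [h|h] := leP (ip f g) 0.
  by apply: le_trans h _; rewrite mulr_ge0 ?l2norm_ge0.
rewrite -(@ler_pXn2r _ 2) ?nnegrE ?mulr_ge0 ?l2norm_ge0 ?(ltW h) //.
by rewrite exprMn !l2norm_sqr; apply: ip_CS.
Qed.

Lemma l2normD f g : l2norm (f + g) <= l2norm f + l2norm g.
Proof.
rewrite -(@ler_pXn2r _ 2) ?nnegrE ?addr_ge0 ?l2norm_ge0 //.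
rewrite sqrrD !l2norm_sqr ipDl !ipDr (ipC g f) mulr2n.
by have := ip_le_norm f g; lra.
Qed.

Lemma scaleC_split (a : C) (f : ell2) :
  a *: f = (complex.Re a)%:C *: f + (complex.Im a)%:C *: ('i *: f).
Proof. by rewrite {1}(complexE a) scalerDl scalerA mulrC. Qed.

Lemma ipi0 f : ip f ('i *: f) = 0.
Proof. by have := ipiN f f; rewrite (ipC _ f); lra. Qed.

Lemma ipZZ (a : C) f : ip (a *: f) (a *: f) = rdot a a * ip f f.
Proof.
rewrite (scaleC_split a f) ipDl !ipDr !ipZl !ipZr ipii ipiN (ipi0 f) /rdot.
ring.
Qed.

Definition l2normC f : C := (l2norm f)%:C.

Lemma l2normCD f g : l2normC (f + g) <= l2normC f + l2normC g.
Proof. by rewrite -[leRHS]rmorphD lecR l2normD. Qed.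

Lemma l2normCZ (a : C) f : l2normC (a *: f) = `|a| * l2normC f.
Proof.
rewrite /l2normC /l2norm ipZZ sqrtrM ?rdot_ge0 // normc_def -rmorphM.
by rewrite /rdot -!expr2.
Qed.

Lemma l2normC_eq0 f : l2normC f = 0 -> f = 0.
Proof.
move=> /complexI h; apply: ip_eq0.
by rewrite -l2norm_sqr h expr0n.
Qed.

HB.instance Definition _ :=
  Lmodule_isNormed.Build C ell2 l2normCD l2normCZ l2normC_eq0.

Lemma ell2_normE (f : ell2) : `|f| = (l2norm f)%:C. Proof. by []. Qed.

End SquareSummable.
Section Ell2Hilbert.
Variable R : realType.
Local Notation C := R[i].
Local Notation ell2 := (ell2 R).
Implicit Types f g h : ell2.

(** The imaginary part of <f, g> is the real part of <f, i g>. *)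
Definition dotC f g : C := ip f g +i* ip f ('i *: g).

Lemma dotC_lin g : scalar (dotC^~ g).
Proof.
move=> a f h; rewrite (scaleC_split a f) /dotC !ipDl !ipZl ipii !ipiN.
case: a => a b; rewrite /=; apply/eqP; rewrite eq_complex /=.
by apply/andP; split; apply/eqP; ring.
Qed.

Lemma dotC_herm f g : dotC f g = (-1) ^+ false * Num.conj (dotC g f).
Proof.
rewrite expr0 mul1r /dotC (ipC g f) (ipC g) ipiN.
by apply/eqP; rewrite eq_complex /= opprK !eqxx.
Qed.

Lemma dotC_linr f : linear_for (Num.conj \; *%R) (dotC f).
Proof.
move=> a g h; rewrite dotC_herm dotC_lin expr0 mul1r rmorphD rmorphM /=.
by rewrite (dotC_herm f g) (dotC_herm f h) !expr0 !mul1r.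
Qed.

Lemma dotC_gt0 f : f != 0 -> 0 < dotC f f.
Proof.
move=> f0; rewrite /dotC ipi0 ltcR lt_def ip_ge0 andbT.
by apply: contra f0 => /eqP /ip_eq0 ->.
Qed.

HB.instance Definition _ := bilinear_isBilinear.Build C ell2 ell2 C
  *%R (Num.conj \; *%R) dotC (dotC_lin, dotC_linr).
HB.instance Definition _ :=
  isHermitianSesquilinear.Build C ell2 false Num.conj dotC dotC_herm.
HB.instance Definition _ := isDotProduct.Build C ell2 dotC dotC_gt0.

Lemma dotC_norm f : `|f| ^+ 2 = dotC f f.
Proof. by rewrite ell2_normE -rmorphXn l2norm_sqr /dotC ipi0. Qed.

End Ell2Hilbert.
Section Ell2Complete.
Variable R : realType.
Local Notation C := R[i].
Local Notation ell2 := (ell2 R).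
Implicit Types f g h : ell2.

Lemma coord_le f k :
  `|complex.Re (f k)| <= l2norm f /\ `|complex.Im (f k)| <= l2norm f.
Proof.
have h := coord_le_ip f k; rewrite -l2norm_sqr /rdot -!expr2 in h.
have h1 := sqr_ge0 (complex.Re (f k)); have h2 := sqr_ge0 (complex.Im (f k)).
by split; rewrite -(@ler_pXn2r _ 2) ?nnegrE ?l2norm_ge0 // real_normK ?num_real //; lra.
Qed.

Lemma l2norm_le f B : 0 <= B ->
  (forall n, \sum_(k < n) rdot (f k) (f k) <= B ^+ 2) -> l2norm f <= B.
Proof.
move=> B0 hB; rewrite -(@ler_pXn2r _ 2) ?nnegrE ?l2norm_ge0 // l2norm_sqr.
exact: ip_le.
Qed.

Lemma ell2_ball f (e : R) g : ball f e%:C g = (l2norm (f - g) < e) :> Prop.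
Proof. by rewrite -ball_normE /ball_ /= ell2_normE ltcR. Qed.

(** The coordinates converge along a Cauchy filter, and the estimates on partial sums
pass to the coordinatewise limit because each involves finitely many terms. *)
Lemma ell2_complete (F : set_system ell2) :
  ProperFilter F -> cauchy F -> cvg F.
Proof.
move=> FF /cauchyP Fc.
have Fc' (e : R) : 0 < e -> exists f, F [set g | l2norm (f - g) < e].
  move=> e0; have [|f hf] := Fc e%:C; first by rewrite ltcR.
  by exists f; apply: filterS hf => g; rewrite ell2_ball.
have cR (G : C -> R) k :
    (forall f g, `|G (f k) - G (g k)| <= l2norm (f - g)) ->
    cvg ((fun f : ell2 => G (f k)) @ F).
  move=> hG; apply: cauchy_cvg; apply/cauchyP => e e0.
  have [f hf] := Fc' e e0; exists (G (f k)).
  rewrite /nbhs /= /nbhs /=; apply: filterS hf => g hg; rewrite -ball_normE /ball_ /=.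
  exact: le_lt_trans (hG f g) hg.
have cRe k : cvg ((fun f : ell2 => complex.Re (f k)) @ F).
  by apply: cR => f g; rewrite -raddfB; have [] := coord_le (f - g) k.
have cIm k : cvg ((fun f : ell2 => complex.Im (f k)) @ F).
  by apply: cR => f g; rewrite -raddfB; have [] := coord_le (f - g) k.
pose l k : C := lim ((fun f : ell2 => complex.Re (f k)) @ F) +i*
                lim ((fun f : ell2 => complex.Im (f k)) @ F).
have near_l f (e : R) : F [set g | l2norm (f - g) < e] -> forall n,
    \sum_(k < n) rdot (f k - l k) (f k - l k) <= e ^+ 2.
  move=> hf n.
  pose S g := \sum_(k < n) rdot (f k - g k) (f k - g k).
  have cS : S g @[g --> F] --> \sum_(k < n) rdot (f k - l k) (f k - l k).
    apply: cvg_big => [|k _]; first exact: add_continuous.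
    have cr : complex.Re (f k) - complex.Re ((g : ell2) k) @[g --> F] -->
        complex.Re (f k) - complex.Re (l k).
      by apply: cvgB; [exact: cvg_cst | exact: cRe].
    have ci : complex.Im (f k) - complex.Im ((g : ell2) k) @[g --> F] -->
        complex.Im (f k) - complex.Im (l k).
      by apply: cvgB; [exact: cvg_cst | exact: cIm].
    rewrite (_ : (fun g : ell2 => _) = (fun g : ell2 =>
        (complex.Re (f k) - complex.Re (g k)) * (complex.Re (f k) - complex.Re (g k))
      + (complex.Im (f k) - complex.Im (g k)) * (complex.Im (f k) - complex.Im (g k)))).
      by rewrite /rdot !raddfB; exact: cvgD (cvgM cr cr) (cvgM ci ci).
    by apply/funext => g; rewrite /rdot !raddfB.
  rewrite -(cvg_lim _ cS) //; apply: limr_le.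
    by apply/cvg_ex; exists (\sum_(k < n) rdot (f k - l k) (f k - l k)).
  apply: filterS hf => g hg; rewrite /S.
  apply: le_trans (ip_series_le (f - g) n) _.
  by rewrite -l2norm_sqr ler_pXn2r ?nnegrE ?l2norm_ge0 // ltW // (le_lt_trans _ hg) ?l2norm_ge0.
have lP : l \in @sqsummable R.
  have [f hf] := Fc' 1 ltr01.
  have d : (f : nat -> C) - l \in @sqsummable R.
    by apply/asboolP; exists (1 ^+ 2) => n; apply: near_l.
  have -> : l = (f : nat -> C) - ((f : nat -> C) - l) by rewrite opprB addrC subrK.
  by rewrite rpredB // ell2P.
apply/cvg_ex; exists (Ell2 lP); apply/cvgrPdist_lt => e e0.
have eE : e = (complex.Re e)%:C by rewrite RRe_real // gtr0_real.
have e0' : 0 < complex.Re e by rewrite -ltcR -eE.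
have [|f hf] := Fc' (complex.Re e / 4); first by rewrite divr_gt0.
apply: filterS (hf) => g hg; rewrite ell2_normE eE ltcR.
rewrite -(subrK f (Ell2 lP)) -addrA.
apply: le_lt_trans (l2normD _ _) _.
have : l2norm (Ell2 lP - f) <= complex.Re e / 4.
  apply: l2norm_le => [|n]; first by rewrite ltW // divr_gt0.
  under eq_bigr do rewrite ell2BE -opprB rdot_normN.
  exact: near_l.
move: hg; rewrite /=; lra.
Qed.

HB.instance Definition _ := Uniform_isComplete.Build ell2 ell2_complete.

Lemma sum_finsupp (F : nat -> R) n m : (forall k, 0 <= F k) ->
  (forall k, (n <= k)%N -> F k = 0) -> \sum_(k < m) F k <= \sum_(k < n) F k.
Proof.
move=> F0 Fn; rewrite -!(big_mkord xpredT F).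
have [mn|nm] := leqP m n.
  rewrite [leRHS](big_cat_nat _ (n := m)) //= lerDl.
  by apply: sumr_ge0.
rewrite (big_cat_nat _ (n := n)) //= ?(ltnW nm) //.
by rewrite gerDl big_nat_cond big1 // => k /andP[/andP[h _] _]; exact: Fn.
Qed.

Lemma finsupp_sqsummable (f : nat -> C) n :
  (forall k, (n <= k)%N -> f k = 0) -> f \in @sqsummable R.
Proof.
move=> fn; apply/asboolP; exists (\sum_(k < n) rdot (f k) (f k)) => m.
apply: (sum_finsupp (F := fun k => rdot (f k) (f k))) => k; first exact: rdot_ge0.
by move=> /fn ->; rewrite rdot0l.
Qed.

Fact trunc_subproof n f :
  (fun k => if (k < n)%N then f k else 0) \in @sqsummable R.
Proof. by apply: (@finsupp_sqsummable _ n) => k; rewrite leqNgt => /negbTE ->. Qed.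

Definition trunc n f : ell2 := Ell2 (trunc_subproof n f).

Lemma truncE n f k : trunc n f k = if (k < n)%N then f k else 0.
Proof. by []. Qed.

Lemma trunc_approx f (e : R) : 0 < e -> exists n, l2norm (f - trunc n f) < e.
Proof.
move=> e0; have := @sq_cvg _ f; rewrite -/(ip f f).
move=> /cvgrPdist_lt /(_ (e ^+ 2)).
rewrite exprn_gt0 // => /(_ isT) [n _ /(_ n (leqnn n))] /= hn.
exists n; have dE k : (f - trunc n f) k = if (k < n)%N then 0 else f k.
  by rewrite ell2BE truncE; case: ifP; rewrite ?subrr ?subr0.
move: (f - trunc n f) dE => d dE.
rewrite -(@ltr_pXn2r _ 2) ?nnegrE ?l2norm_ge0 ?(ltW e0) //.
rewrite l2norm_sqr; apply: le_lt_trans hn.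
apply: le_trans (ler_norm _); apply: ip_le => m.
rewrite lerBrDr /series /= big_mkord.
have [mn|nm] := leqP m n.
  rewrite big1 ?add0r ?ip_series_le // => k _.
  by rewrite dE (leq_trans (ltn_ord k)) // rdot0l.
apply: le_trans (ip_series_le f m).
rewrite -!(big_mkord xpredT (fun k => rdot (f k) (f k))).
rewrite -(big_mkord xpredT (fun k => rdot (d k) (d k))).
rewrite (big_cat_nat _ (n := n)) //= ?(ltnW nm) //.
rewrite [leRHS](big_cat_nat _ (n := n)) //= ?(ltnW nm) //.
rewrite [X in X + _ + _]big_nat_cond big1 ?add0r; last first.
  by move=> k /andP[/andP[_ kn] _]; rewrite dE kn rdot0l.
rewrite addrC; apply: lerD => //; rewrite big_nat_cond [leRHS]big_nat_cond.
apply: ler_sum => k /andP[/andP[nk _] _].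
by rewrite dE ltnNge nk.
Qed.

Fact ratseq_subproof (s : seq (rat * rat)) :
  (fun k => ratr (nth (0, 0) s k).1 +i* ratr (nth (0, 0) s k).2)
    \in @sqsummable R.
Proof.
apply: (@finsupp_sqsummable _ (size s)) => k ks.
by rewrite nth_default //= raddf0.
Qed.

Definition ratseq s : ell2 := Ell2 (ratseq_subproof s).

(** Finitely supported sequences with rational real and imaginary parts are dense:
truncate, then approximate the remaining coordinates. *)
Lemma ell2_separable : exists2 D : set ell2, countable D & dense D.
Proof.
exists (range ratseq).
  by apply: sub_countable (card_image_le _ _) _; apply: countableP.
move=> O [f Of] Oo.
have /nbhs_ballP[e e0 eO] : nbhs f O by apply: open_nbhs_nbhs; split.
have eE : e = (complex.Re e)%:C by rewrite RRe_real // gtr0_real.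
move: (complex.Re e) eE => d eE; rewrite eE in e0 eO; rewrite /= ltcR in e0.
have [|n hn] := @trunc_approx f (d / 2); first by rewrite divr_gt0.
(* Each of the n coordinates contributes at most 2 c ^ 2 to the squared error. *)
pose c := d / (8 * n.+1%:R).
have c0 : 0 < c by rewrite divr_gt0 ?mulr_gt0.
have app (x : R) : exists q : rat, `|x - ratr q| < c.
  have [|q] := @rat_in_itvoo R (x - c) (x + c).
    by rewrite ltrD2l gtrN.
  by rewrite in_itv /= => h; exists q; rewrite distrC ltr_distl.
have [Q hQ] : exists Q : R -> rat, forall x, `|x - ratr (Q x)| < c.
  by have [Q hQ] := choice app; exists Q.
pose s := mkseq (fun k => (Q (complex.Re (f k)), Q (complex.Im (f k)))) n.
exists (ratseq s); split; last by exists s.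
apply: eO; rewrite ell2_ball -(subrK (trunc n f) f) -addrA.
apply: le_lt_trans (l2normD _ _) _.
suff : l2norm (trunc n f - ratseq s) <= d / 2 by move: hn; lra.
apply: l2norm_le => [|m]; first by rewrite divr_ge0 // ltW.
pose F k := rdot ((trunc n f - ratseq s) k) ((trunc n f - ratseq s) k).
have FE k : F k = if (k < n)%N then
    rdot (f k - (ratr (Q (complex.Re (f k))) +i* ratr (Q (complex.Im (f k)))))
         (f k - (ratr (Q (complex.Re (f k))) +i* ratr (Q (complex.Im (f k)))))
    else 0.
  rewrite /F ell2BE truncE /=; case: ifP => kn; first by rewrite nth_mkseq.
  rewrite nth_default ?size_mkseq 1?leqNgt ?kn //= raddf0.
  by rewrite (_ : 0 +i* 0 = 0) // subrr rdot0l.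
apply: (@le_trans _ _ (\sum_(k < n) F k)).
  apply: sum_finsupp => k; first exact: rdot_ge0.
  by rewrite FE ltnNge => ->.
apply: (@le_trans _ _ (\sum_(k < n) (2 * c ^+ 2))).
  apply: ler_sum => k _; rewrite FE ltn_ord.
  have hr := hQ (complex.Re (f k)); have hi := hQ (complex.Im (f k)).
  case: (f k) hr hi => x y /= hr hi; rewrite /rdot /= -!expr2.
  have sq (u : R) : `|u| < c -> u ^+ 2 <= c ^+ 2.
    by move=> uc; rewrite -(real_normK (num_real u)) ler_pXn2r ?nnegrE ?(ltW uc) ?(ltW c0).
  by have := sq _ hr; have := sq _ hi; lra.
rewrite sumr_const card_ord -[leLHS]mulr_natl /c.
have n1 : n%:R <= n.+1%:R :> R by rewrite ler_nat.
have n0 : 0 < n.+1%:R :> R by [].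
apply: (@le_trans _ _ (n.+1%:R * (2 * (d / (8 * n.+1%:R)) ^+ 2))).
  by apply: ler_wpM2r => //; rewrite mulr_ge0 // sqr_ge0.
have -> : n.+1%:R * (2 * (d / (8 * n.+1%:R)) ^+ 2) = d ^+ 2 / 32 / n.+1%:R.
  by move: n0; move: n.+1%:R => N1 /lt0r_neq0 n0; field.
rewrite ler_pdivrMr //; apply: (@le_trans _ _ (d ^+ 2 / 4)).
  by have := sqr_ge0 d; lra.
have -> : (d / 2) ^+ 2 = d ^+ 2 / 4 by field.
by rewrite ler_peMr ?divr_ge0 ?sqr_ge0 // ler1n.
Qed.

Definition ell2_hilbert : hilbertSpace R :=
  @HilbertSpace R ell2 (@dotC R) (@dotC_norm R) ell2_separable.


End Ell2Complete.
(** * The unit circle *)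

Section Circle.
Variable R : realType.
Local Notation C := R[i].
Implicit Types (s t : R) (z w : C).

(** The character exp (2 i pi t), of period 1. *)
Definition circ t : C := cos (2 * pi * t) +i* sin (2 * pi * t).

Lemma circD s t : circ (s + t) = circ s * circ t.
Proof.
rewrite /circ mulrDr cosD sinD; apply/eqP; rewrite eq_complex /=.
by rewrite eqxx /= addrC.
Qed.

Lemma circ0 : circ 0 = 1.
Proof. by rewrite /circ mulr0 cos0 sin0. Qed.

Lemma circ_conj t : Num.conj (circ t) = circ (- t).
Proof.
by rewrite /circ mulrN cosN sinN; apply/eqP; rewrite eq_complex /= !eqxx.
Qed.

Lemma norm_circ t : `|circ t| = 1.
Proof. by rewrite normc_def /= cos2Dsin2 sqrtr1. Qed.

Lemma circ_nat (n : nat) : circ n%:R = 1.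
Proof.
elim: n => [|n IH]; first exact: circ0.
rewrite -natr1 circD IH mul1r /circ mulr1 mulr_natl.
by rewrite cos2pi sin2pi.
Qed.

Lemma circ_int (k : int) : circ k%:~R = 1.
Proof.
case: k => n; first exact: circ_nat.
rewrite NegzE rmorphN /= -circ_conj.
by rewrite (circ_nat n.+1) rmorph1.
Qed.

Lemma circDint t (k : int) : circ (t + k%:~R) = circ t.
Proof. by rewrite circD circ_int mulr1. Qed.

Lemma sin_le_norm t : `|sin t| <= `|t|.
Proof.
have key (x : R) : 0 <= x -> `|sin x| <= `|x|.
  move=> x0.
  have ds y : y \in `]0, x[%R -> is_derive y 1 (@sin R) (cos y).
    by move=> _; apply: is_derive_sin.
  have cs : {within `[0, x], continuous (@sin R)}.
    by apply: continuous_subspaceT => y; apply: continuous_sin.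
  have [c _] := MVT_segment x0 ds cs.
  rewrite sin0 !subr0 => ->; rewrite normrM ler_piMl //; exact: cos_max.
have [/key//|/ltW t0] := leP 0 t.
by rewrite -normrN -sinN -[leRHS]normrN key // oppr_ge0.
Qed.

(** The norm of R[i] takes its values in R[i]; this is the modulus as a real. *)
Definition cabs z : R := complex.Re `|z|.

Lemma cabsE z : `|z| = (cabs z)%:C.
Proof. by rewrite /cabs RRe_real // normr_real. Qed.

Lemma cabs_ge0 z : 0 <= cabs z.
Proof. by rewrite -lecR -cabsE normr_ge0. Qed.

Lemma cos2E (x : R) : cos (2 * x) = 1 - 2 * sin x ^+ 2.
Proof. by rewrite mulr_natl cos_mulr2n cos2sin2 mulr2n; ring. Qed.

(** |exp (2 i pi t) - 1| = 2 |sin (pi t)|. *)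
Lemma circ_sub1 t : `|circ t - 1| <= (2 * pi * `|t|)%:C.
Proof.
rewrite normc_def lecR /circ /= subr0.
rewrite -(@ler_pXn2r _ 2) ?nnegrE ?sqrtr_ge0 ?mulr_ge0 ?pi_ge0 //.
rewrite sqr_sqrtr ?addr_ge0 ?sqr_ge0 //.
have -> : (cos (2 * pi * t) - 1) ^+ 2 + sin (2 * pi * t) ^+ 2 =
  2 - 2 * cos (2 * pi * t).
  by have := cos2Dsin2 (2 * pi * t); rewrite sqrrB mulr1 expr1n; lra.
rewrite -mulrA cos2E.
have : sin (pi * t) ^+ 2 <= (pi * `|t|) ^+ 2.
  rewrite -real_normK ?num_real // ler_pXn2r ?nnegrE ?mulr_ge0 ?pi_ge0 //.
  by rewrite (le_trans (sin_le_norm _)) // normrM ger0_norm // pi_ge0.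
rewrite -mulrA [in leRHS]exprMn; lra.
Qed.

(** Reduce k modulo M; the sine of pi r / M is positive for 0 < r < M. *)
Lemma circ_eq1 (M : nat) (k : int) : (0 < M)%N ->
  circ (k%:~R / M%:R) = 1 -> (M%:Z %| k)%Z.
Proof.
move=> M0; have MR : M%:R != 0 :> R by rewrite pnatr_eq0 -lt0n.
have -> : k%:~R / M%:R = (k %% M)%Z%:~R / M%:R + ((k %/ M)%Z)%:~R :> R.
  rewrite {1}(divz_eq k M) rmorphD rmorphM /=.
  by field.
rewrite circDint => h.
have r0 : 0 <= (k %% M)%Z by rewrite modz_ge0 // eqz_nat -lt0n.
have rM : (k %% M)%Z < M by rewrite ltz_pmod.
apply/dvdz_mod0P; apply/eqP; apply: contraT => rn0.
have r1 : 0 < (k %% M)%Z by rewrite lt_def rn0.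
have := congr1 (@complex.Re R) h; rewrite /circ /= -mulrA cos2E => hs.
suff : 0 < sin (pi * ((k %% M)%Z%:~R / M%:R) : R).
  by move=> s0; have := exprn_gt0 2 s0; lra.
have M0' : 0 < M%:R :> R by rewrite ltr0n.
apply: sin_gt0_pi; rewrite mulr_gt0 ?pi_gt0 ?divr_gt0 ?ltr0z //=.
rewrite gtr_pMr ?pi_gt0 // ltr_pdivrMr // mul1r.
by rewrite (_ : M%:R = (M%:Z)%:~R :> R) ?ltr_int.
Qed.

(** The midpoint of two distinct points of the circle is inside the disc. *)
Lemma cabs_half_lt1 w : `|w| = 1 -> w != 1 -> cabs ((1 + w) / 2) < 1.
Proof.
case: w => x y; rewrite normc_def /= => /complexI.
move=> /(congr1 (fun u => u ^+ 2)); rewrite sqr_sqrtr ?addr_ge0 ?sqr_ge0 // expr1n.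
move=> h1 h2; rewrite -ltcR -cabsE normf_div (ger0_norm (ler0n _ 2)).
rewrite ltr_pdivrMr // mul1r normc_def /= add0r.
rewrite -[ltRHS](rmorph_nat (real_complex R) 2) ltcR.
rewrite -[ltRHS]ger0_norm // -sqrtr_sqr ltr_sqrt ?exprn_gt0 //.
have x1 : x < 1.
  rewrite lt_def; apply/andP; split.
    apply: contra h2 => /eqP x1; rewrite eq_complex /= -x1 eqxx /=.
    by move: h1; rewrite -x1 expr1n -(sqrf_eq0 y); lra.
  by have := sqr_ge0 y; nra.
by nra.
Qed.

End Circle.
(** * Inner products *)

Section HilbertBasics.
Variables (R : realType) (H : hilbertSpace R).
Local Notation C := R[i].
Implicit Types (x y z : H) (a : C).
Local Notation "''[' x , y ]" := (hdot H x y).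

Lemma hdotDl x y z : '[x + y, z] = '[x, z] + '[y, z].
Proof. exact: linearDl. Qed.
Lemma hdotBl x y z : '[x - y, z] = '[x, z] - '[y, z].
Proof. exact: linearBl. Qed.
Lemma hdotZl a x y : '[a *: x, y] = a * '[x, y].
Proof. exact: linearZl_LR. Qed.
Lemma hdotDr x y z : '[z, x + y] = '[z, x] + '[z, y].
Proof. exact: linearDr. Qed.
Lemma hdotBr x y z : '[z, x - y] = '[z, x] - '[z, y].
Proof. exact: linearBr. Qed.
Lemma hdotZr a x y : '[x, a *: y] = (Num.conj a) * '[x, y].
Proof. exact: linearZr_LR. Qed.
Lemma hdot_conj x y : Num.conj '[x, y] = '[y, x].
Proof. by rewrite [RHS]hermC expr0 mul1r. Qed.

(** Positivity of the norm of <y, y> x - <x, y> y. *)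
Lemma hdot_CS x y : `|'[x, y]| <= `|x| * `|y|.
Proof.
have [->|y0] := eqVneq y 0.
  by rewrite -[0](scale0r (0 : H)) hdotZr rmorph0 mul0r normr0 mulr_ge0.
have c0 : 0 < '[y, y] by rewrite -hdot_norm exprn_gt0 // normr_gt0.
have cc : Num.conj '[y, y] = '[y, y] by rewrite hdot_conj.
rewrite -(@ler_pXn2r _ 2) ?nnegrE ?mulr_ge0 //.
rewrite exprMn !hdot_norm normCK.
have : 0 <= '['[y, y] *: x - '[x, y] *: y, '[y, y] *: x - '[x, y] *: y].
  by rewrite -hdot_norm exprn_ge0.
rewrite !hdotBl !hdotBr !hdotZl !hdotZr cc -(hdot_conj x y).
set a := '[x, x]; set b := '[x, y]; set c := '[y, y] in c0 *.
rewrite (_ : _ - _ = c * (a * c - b * Num.conj b)); last by ring.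
by rewrite pmulr_rge0 // subr_ge0.
Qed.

Lemma hdot_cvgl (u : nat -> H) x y :
  u n @[n --> \oo] --> x -> ('[u n, y] : C^o) @[n --> \oo] --> ('[x, y] : C^o).
Proof.
move=> ux; apply/cvgrPdist_lt => e e0.
have y0 : 0 < `|y| + 1 by rewrite ltr_wpDl.
have /cvgrPdist_lt /(_ (e / (`|y| + 1))) := ux.
rewrite divr_gt0 // => /(_ isT); apply: filterS => n hn.
rewrite -hdotBl; apply: le_lt_trans (hdot_CS _ _) _.
apply: (@le_lt_trans _ _ (`|x - u n| * (`|y| + 1))).
  by rewrite ler_wpM2l // lerDl.
by rewrite -ltr_pdivlMr.
Qed.

Lemma hdot_cvgr (u : nat -> H) x y :
  u n @[n --> \oo] --> y -> ('[x, u n] : C^o) @[n --> \oo] --> ('[x, y] : C^o).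
Proof.
move=> uy; apply/cvgrPdist_lt => e e0.
have /cvgrPdist_lt /(_ e e0) := hdot_cvgl (y := x) uy; apply: filterS => n.
by rewrite -hdotBr -hdotBl -(hdot_conj (y - u n)) norm_conjC.
Qed.

Lemma C_cvg_unique (u : nat -> C) (a b : C) :
  (u n : C^o) @[n --> \oo] --> (a : C^o) ->
  (u n : C^o) @[n --> \oo] --> (b : C^o) -> a = b.
Proof. exact: (cvg_unique (@norm_hausdorff C C^o)). Qed.

Lemma H_cvg_unique (u : nat -> H) (a b : H) :
  u n @[n --> \oo] --> a -> u n @[n --> \oo] --> b -> a = b.
Proof. exact: (cvg_unique (@norm_hausdorff C H)). Qed.

End HilbertBasics.

(** * Unitary operators with summable angles *)

(** Commuting orthogonal projections, which carry a joint functional calculus. *)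
Record projFamily (R : realType) (H : hilbertSpace R) := ProjFamily {
  proj :> nat -> {linear H -> H};
  proj_idem : forall j x, proj j (proj j x) = proj j x;
  proj_sa : forall j x y, hdot H (proj j x) y = hdot H x (proj j y);
  proj_comm : forall i j x, proj i (proj j x) = proj j (proj i x)
}.

Definition summable_phase (R : realType) (t : nat -> R) :=
  cvgn (series (fun j => `|t j|)).

Section Summable.
Variable R : realType.
Implicit Types t s : nat -> R.

Definition phase_norm t : R := limn (series (fun j => `|t j|)).

Lemma series_phase_le t n : summable_phase t ->
  \sum_(0 <= j < n) `|t j| <= phase_norm t.
Proof.
move=> st; apply: (nondecreasing_cvgn_le (u_ := series _)) => //.
by apply/nondecreasing_seqP => m; rewrite seriesSr lerDl.
Qed.

Lemma phase_tail t : summable_phase t -> forall e : R, 0 < e ->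
  exists N, forall n k, (N <= n)%N -> \sum_(n <= j < n + k) `|t j| < e.
Proof.
move=> st e e0; have /cvgrPdist_lt /(_ e e0) [N _ hN] := st.
exists N => n k Nn; have := hN n Nn; rewrite /= -/(phase_norm t).
apply: le_lt_trans; apply: le_trans (ler_norm _).
rewrite lerBrDl; apply: le_trans (series_phase_le (n + k) st).
by rewrite [leRHS](big_cat_nat _ (n := n)) //= leq_addr.
Qed.

Lemma summable_le t s : (forall j, `|t j| <= `|s j|) ->
  summable_phase s -> summable_phase t.
Proof. by move=> ts; apply: series_le_cvg => // j; apply: ts. Qed.

Lemma summable_phaseN t : summable_phase t -> summable_phase (\- t).
Proof. by apply: summable_le => j /=; rewrite normrN. Qed.

Lemma summable_phaseD t s : summable_phase t -> summable_phase s ->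
  summable_phase (t \+ s).
Proof.
move=> st ss.
apply: (@series_le_cvg _ _ (fun j => `|t j| + `|s j|)) => [j|j|j|] //=.
- by rewrite addr_ge0.
- exact: ler_normD.
exact: is_cvg_seriesD.
Qed.

Lemma summable_phaseZ (c : R) t : summable_phase t ->
  summable_phase (fun j => c * t j).
Proof.
move=> st; rewrite /summable_phase.
rewrite (_ : (fun j => _) = `|c| *: (fun j => `|t j|)).
  exact: is_cvg_seriesZ.
by apply/funext => j; rewrite normrM.
Qed.

End Summable.

Section PhaseCalculus.
Variables (R : realType) (H : hilbertSpace R) (E : projFamily H).
Local Notation C := R[i].
Local Notation "''[' x , y ]" := (hdot H x y).
Implicit Types (t s : nat -> R) (x y : H).

(** |E x| ^ 2 = <x, E x>, by idempotence and self-adjointness. *)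
Lemma proj_le j x : `|E j x| <= `|x|.
Proof.
have [->|n0] := eqVneq (E j x) 0; first by rewrite normr0.
have p : 0 < `|E j x| by rewrite normr_gt0.
rewrite -(ler_pM2r p) -expr2 hdot_norm proj_sa proj_idem -proj_sa.
apply: le_trans (hdot_CS x (E j x)).
by rewrite -proj_sa real_ler_norm // -[E j x](proj_idem E) proj_sa -hdot_norm ger0_real // exprn_ge0.
Qed.

Lemma projDZ j x a y : E j (x + a *: y) = E j x + a *: E j y.
Proof. by rewrite addrC linearP addrC. Qed.

(** The unitary operator exp (2 i pi t_j E_j); phase_part composes the first n of
them. *)
Definition phase_step t j x : H := x + (circ (t j) - 1) *: E j x.

Fixpoint phase_part t n x : H :=
  if n is n'.+1 then phase_step t n' (phase_part t n' x) else x.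

Lemma phase_step_lin t j a x y :
  phase_step t j (a *: x + y) = a *: phase_step t j x + phase_step t j y.
Proof.
rewrite /phase_step linearP !scalerDr !scalerA addrACA.
by rewrite [_ * a]mulrC.
Qed.

Lemma phase_part_lin t n a x y :
  phase_part t n (a *: x + y) = a *: phase_part t n x + phase_part t n y.
Proof. by elim: n => //= n ->; apply: phase_step_lin. Qed.

Lemma phase_step_comm t s i j x :
  phase_step t i (phase_step s j x) = phase_step s j (phase_step t i x).
Proof.
rewrite /phase_step !projDZ (proj_comm E i j).
rewrite !scalerDr !scalerA [(circ (t i) - 1) * _]mulrC.
by rewrite addrACA.
Qed.

Lemma phase_stepD t s j x :
  phase_step t j (phase_step s j x) = phase_step (t \+ s) j x.
Proof.
rewrite /phase_step projDZ proj_idem -addrA; congr (_ + _).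
rewrite scalerDr scalerA -!scalerDl circD; congr (_ *: _).
by ring.
Qed.

Lemma phase_step0 t j x : t j = 0 -> phase_step t j x = x.
Proof. by move=> t0; rewrite /phase_step t0 circ0 subrr scale0r addr0. Qed.

Lemma phase_step_adj t j x y :
  '[phase_step t j x, y] = '[x, phase_step (\- t) j y].
Proof.
rewrite /phase_step hdotDl hdotDr hdotZl hdotZr proj_sa; congr (_ + _ * _).
by rewrite rmorphB rmorph1 /= circ_conj opprK.
Qed.

Lemma phase_part_step t s n j x :
  phase_part t n (phase_step s j x) = phase_step s j (phase_part t n x).
Proof. by elim: n => //= n ->; apply: phase_step_comm. Qed.

Lemma phase_partD t s n x :
  phase_part t n (phase_part s n x) = phase_part (t \+ s) n x.
Proof. by elim: n => //= n <-; rewrite phase_part_step phase_stepD. Qed.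

Lemma phase_part0 t n x : (forall j, t j = 0) -> phase_part t n x = x.
Proof. by move=> t0; elim: n => //= n ->; apply: phase_step0. Qed.

Lemma phase_part_adj t n x y :
  '[phase_part t n x, y] = '[x, phase_part (\- t) n y].
Proof.
elim: n x y => //= n IH x y.
by rewrite phase_step_adj IH phase_part_step.
Qed.

Lemma phase_part_norm t n x : `|phase_part t n x| = `|x|.
Proof.
apply/eqP; rewrite -(@eqrXn2 _ 2) // !hdot_norm; apply/eqP.
rewrite phase_part_adj phase_partD phase_part0 // => j.
by rewrite /= addNr.
Qed.

(** The step moves x by (exp (2 i pi t_j) - 1) E_j x. *)
Lemma phase_step_le t j x : 
  `|phase_step t j x - x| <= (2 * pi * `|t j|)%:C * `|x|.
Proof.
rewrite /phase_step addrC addKr normrZ ler_pM //; last exact: proj_le.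
exact: circ_sub1.
Qed.

(** Telescoping over the last k steps, each applied to a vector of norm |x|. *)
Lemma phase_part_le t n k x :
  `|phase_part t (n + k)%N x - phase_part t n x| <=
    (2 * pi * \sum_(n <= j < n + k) `|t j|)%:C * `|x|.
Proof.
elim: k => [|k IH]; first by rewrite addn0 subrr big_geq // mulr0 mul0r normr0.
rewrite addnS /= -(subrK (phase_part t (n + k) x) (phase_step _ _ _)) -addrA.
apply: le_trans (ler_normD _ _) _.
apply: le_trans (lerD (phase_step_le _ _ _) IH) _.
rewrite phase_part_norm -mulrDl -rmorphD; apply: ler_wpM2r => //.
by rewrite lecR big_nat_recr ?leq_addr //= -mulrDr [X in _ * X <= _]addrC.
Qed.

Lemma norm_real x : `|x| = (complex.Re `|x|)%:C.
Proof. by rewrite RRe_real // normr_real. Qed.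

(** By phase_part_le the partial products form a Cauchy sequence at each vector. *)
Lemma phase_part_cvg t x : summable_phase t -> cvgn (phase_part t ^~ x).
Proof.
move=> st; apply: cauchy_cvg; apply/cauchyP => e e0.
have eE : e = (complex.Re e)%:C by rewrite RRe_real // gtr0_real.
move: (complex.Re e) eE => d eE; rewrite eE ltcR in e0.
have xE := norm_real x; move: (complex.Re `|x|) xE => r xE.
have r0 : 0 <= r by rewrite -lecR -xE normr_ge0.
have q0 : 0 < 2 * pi * (r + 1) by rewrite mulr_gt0 ?mulr_gt0 ?pi_gt0 ?ltr_wpDl.
have [N hN] := phase_tail st (divr_gt0 e0 q0).
exists (phase_part t N x); exists N => //= n Nn.
rewrite -ball_normE /ball_ /= distrC -(subnKC Nn).
apply: le_lt_trans (phase_part_le _ _ _ _) _.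
rewrite eE xE -rmorphM ltcR.
have := hN N (n - N)%N (leqnn N); rewrite ltr_pdivlMr //.
apply: le_lt_trans.
have : 0 <= \sum_(N <= j < N + (n - N)) `|t j| by apply: sumr_ge0.
move: (\sum_(_ <= _ < _) _) => S S0.
rewrite -subr_ge0 (_ : _ - _ = 2 * pi * S); last by ring.
by rewrite !mulr_ge0 // pi_ge0.
Qed.

(** The operator exp (2 i pi sum_j t_j E_j), for summable angles t. *)
Definition phase_lim t x : H := lim (phase_part t n x @[n --> \oo]).

Section Limit.
Variables (t : nat -> R) (st : summable_phase t).

Lemma phase_limP x : phase_part t n x @[n --> \oo] --> phase_lim t x.
Proof. exact: phase_part_cvg. Qed.

Lemma phase_lim_lin : linear (phase_lim t).
Proof.
move=> a x y; apply: cvg_lim => //.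
rewrite (_ : (fun n => _) = (fun n => a *: phase_part t n x + phase_part t n y)).
  by apply: cvgD; [apply: cvgZr|]; apply: phase_limP.
by apply/funext => n; apply: phase_part_lin.
Qed.

Lemma phase_lim_approx x (e : C) : 0 < e ->
  \forall n \near \oo, `|phase_lim t x - phase_part t n x| < e.
Proof. by move=> e0; move/cvgrPdist_lt: (@phase_limP x); apply. Qed.

End Limit.

Lemma phase_lim_adj t x y : summable_phase t -> summable_phase (\- t) ->
  '[phase_lim t x, y] = '[x, phase_lim (\- t) y].
Proof.
move=> st sNt.
apply: (C_cvg_unique (hdot_cvgl (y := y) (phase_limP st (x := x)))).
rewrite (_ : (fun n => _) = fun n => '[x, phase_part (\- t) n y]).
  exact: hdot_cvgr (phase_limP sNt (x := y)).
by apply/funext => n; rewrite phase_part_adj.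
Qed.

(** The partial products are isometries, so that the inner factor may be replaced by
its limit up to an error that tends to 0. *)
Lemma phase_limD t s x : summable_phase t -> summable_phase s ->
  summable_phase (t \+ s) ->
  phase_lim t (phase_lim s x) = phase_lim (t \+ s) x.
Proof.
move=> st ss sts; apply: H_cvg_unique (phase_limP sts (x := x)).
have h : phase_part s n x - phase_lim s x @[n --> \oo] --> (0 : H).
  by apply/subr_cvg0; exact: phase_limP.
rewrite (_ : (fun n => _) = fun n => 1 *: phase_part t n (phase_part s n x - phase_lim s x)
    + phase_part t n (phase_lim s x)).
  rewrite -[X in _ --> X]add0r; apply: cvgD; last exact: phase_limP.
  apply/norm_cvg0P; under eq_fun do rewrite scale1r phase_part_norm.
  by apply/norm_cvg0P.
apply/funext => n; rewrite scale1r -phase_partD.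
rewrite -[X in _ + X]scale1r addrC -phase_part_lin scale1r.
by rewrite addrC subrK.
Qed.

Lemma phase_lim0 t x : (forall j, t j = 0) -> phase_lim t x = x.
Proof.
move=> t0; apply: cvg_lim => //.
under eq_fun do rewrite phase_part0 //; exact: cvg_cst.
Qed.

(** The estimate that makes the operator depend continuously, in norm, on its
summable angles. *)
Lemma phase_lim_le t x : summable_phase t ->
  `|phase_lim t x - x| <= (2 * pi * phase_norm t)%:C * `|x|.
Proof.
move=> st; apply/ler_addgt0Pr => e e0.
have [N _ /(_ N (leqnn N)) /= hN] := phase_lim_approx st x e0.
rewrite -(subrK (phase_part t N x) (phase_lim t x)) -addrA.
apply: le_trans (ler_normD _ _) _; rewrite [leRHS]addrC; apply: lerD (ltW hN) _.
apply: le_trans (phase_part_le t 0 N x) _.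
apply: ler_wpM2r => //; rewrite lecR; apply: ler_wpM2l.
  by rewrite mulr_ge0 ?pi_ge0.
exact: series_phase_le.
Qed.

Lemma phase_lim_norm t x : summable_phase t -> `|phase_lim t x| = `|x|.
Proof.
move=> st; apply/eqP; rewrite eq_le; apply/andP; split.
  apply/ler_addgt0Pr => e e0.
  have [N _ /(_ N (leqnn N)) /= hN] := phase_lim_approx st x e0.
  rewrite -(phase_part_norm t N x) -(subrK (phase_part t N x) (phase_lim t x)).
  apply: le_trans (ler_normD _ _) _; rewrite addrC lerD2l; exact: ltW.
apply/ler_addgt0Pr => e e0.
have [N _ /(_ N (leqnn N)) /= hN] := phase_lim_approx st x e0.
rewrite -(phase_part_norm t N x) -(subrK (phase_lim t x) (phase_part t N x)).
apply: le_trans (ler_normD _ _) _; rewrite addrC lerD2l distrC; exact: ltW.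
Qed.

Lemma phase_limB t x y : summable_phase t ->
  phase_lim t (x - y) = phase_lim t x - phase_lim t y.
Proof.
by move=> st; rewrite addrC -scaleN1r phase_lim_lin // scaleN1r addrC.
Qed.

(** Isometries are uniformly bounded, so that matrix coefficients need to be
controlled only on approximations of the two vectors. *)
Lemma phase_hdot_approx t x y x' y' : summable_phase t ->
  `|'[phase_lim t x, y]| <=
    `|x - x'| * `|y| + (`|x'| * `|y - y'| + `|'[phase_lim t x', y']|).
Proof.
move=> st; rewrite (_ : '[phase_lim t x, y] = '[phase_lim t (x - x'), y] +
   ('[phase_lim t x', y - y'] + '[phase_lim t x', y'])); last first.
  by rewrite phase_limB // hdotBl hdotBr !subrK.
apply: le_trans (ler_normD _ _) _; apply: lerD.
  by apply: le_trans (hdot_CS _ _) _; rewrite phase_lim_norm.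
apply: le_trans (ler_normD _ _) _; apply: lerD => //.
by apply: le_trans (hdot_CS _ _) _; rewrite phase_lim_norm.
Qed.

(** Only the angles modulo 1 matter. *)
Lemma phase_lim_int t s x : (forall j, exists k : int, s j = t j + k%:~R) ->
  phase_lim s x = phase_lim t x.
Proof.
move=> ts; have part n : phase_part s n x = phase_part t n x.
  elim: n => //= n ->; have [k tk] := ts n.
  by rewrite /phase_step tk circDint.
by rewrite /phase_lim; under eq_fun do rewrite part.
Qed.

End PhaseCalculus.

Section PhaseUnitary.
Variables (R : realType) (H : hilbertSpace R) (E : projFamily H).
Local Notation C := R[i].

Lemma phase_bounded t (st : summable_phase t) : exists M : C, forall x : H,
  `|(HB.pack_for {linear H -> H} (phase_lim E t)
      (GRing.isLinear.Build _ _ _ _ _ (phase_lim_lin E st))) x| <= M * `|x|.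
Proof. by exists 1 => x; rewrite mul1r /= phase_lim_norm. Qed.

Definition phase_op t (st : summable_phase t) : boundedOp H :=
  BoundedOp (phase_bounded st).

Lemma phase_opNK t (st : summable_phase t) :
  cancel (phase_lim E t) (phase_lim E (\- t)).
Proof.
move=> x; have sN := summable_phaseN st.
rewrite phase_limD //; last exact: summable_phaseD.
by apply: phase_lim0 => j /=; rewrite addNr.
Qed.

Lemma phase_opKN t (st : summable_phase t) :
  cancel (phase_lim E (\- t)) (phase_lim E t).
Proof.
move=> x; have sN := summable_phaseN st.
rewrite phase_limD //; last exact: summable_phaseD.
by apply: phase_lim0 => j /=; rewrite addrN.
Qed.

Definition phase_unitary t (st : summable_phase t) : unitaryOp H :=
  @UnitaryOp R H (phase_op st) (phase_op (summable_phaseN st))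
    (fun x y => phase_lim_adj E x y st (summable_phaseN st))
    (phase_opNK st) (phase_opKN st).

(** Integer powers multiply the angles; the adjoint has the opposite angles, which
covers negative powers. *)
Lemma phase_zpow t (st : summable_phase t) (k : int) x :
  unitary_zpow (phase_unitary st) k x = phase_lim E (fun j => k%:~R * t j) x.
Proof.
have H1 n s (ss : summable_phase s) :
    iter n (bop_comp (phase_op ss)) (bop_id H) x =
    phase_lim E (fun j => n%:R * s j) x.
  elim: n => [|n IH] /=; first by rewrite phase_lim0 // => j; rewrite mul0r.
  rewrite IH phase_limD //; first last.
  - by apply: summable_phaseD => //; exact: summable_phaseZ.
  - exact: summable_phaseZ.
  congr (phase_lim _ _ _); apply/funext => j /=.
  by rewrite -natr1 mulrDl mul1r addrC.
case: k => n; first exact: H1.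
rewrite [LHS](H1 n.+1); congr (phase_lim _ _ _); apply/funext => j /=.
by rewrite NegzE rmorphN /= mulrN mulNr.
Qed.

End PhaseUnitary.

(** * Bit flips and their spectral projections *)

Section BitFlip.

(** Flips the j-th binary digit of n.  These are commuting involutions. *)
Definition flip (j n : nat) : nat := Nat.lxor n (2 ^ j).

Lemma flipK j : involutive (flip j).
Proof.
move=> n; rewrite /flip PeanoNat.Nat.lxor_assoc PeanoNat.Nat.lxor_nilpotent.
exact: PeanoNat.Nat.lxor_0_r.
Qed.

Lemma flip_comm i j n : flip i (flip j n) = flip j (flip i n).
Proof.
by rewrite /flip !PeanoNat.Nat.lxor_assoc [Nat.lxor (2 ^ j) _]PeanoNat.Nat.lxor_comm.
Qed.

Lemma expn_pow m : (2 ^ m)%N = Nat.pow 2 m.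
Proof. by elim: m => //= m <-; rewrite expnS; lia. Qed.

Lemma lxor_lt a b m : (a < 2 ^ m)%N -> (b < 2 ^ m)%N -> (Nat.lxor a b < 2 ^ m)%N.
Proof.
have [->|c0] := eqVneq (Nat.lxor a b) 0%N; first by rewrite expn_gt0.
have [->|m0] := eqVneq m 0%N.
  by rewrite expn0 !ltnS !leqn0 => /eqP a0 /eqP b0; rewrite a0 b0 in c0.
have lg x : (x < 2 ^ m)%N -> (PeanoNat.Nat.log2 x < m)%coq_nat.
  case: x => [|x] xm; first by apply/ssrnat.ltP; rewrite lt0n.
  by apply/PeanoNat.Nat.log2_lt_pow2; [lia | apply/ssrnat.ltP; rewrite -expn_pow].
move=> /lg ha /lg hb; apply/ssrnat.ltP; rewrite expn_pow.
apply/PeanoNat.Nat.log2_lt_pow2; first by apply/ssrnat.ltP; rewrite lt0n.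
have := PeanoNat.Nat.log2_lxor a b; lia.
Qed.

Lemma flip_lt j m n : (j < m)%N -> (n < 2 ^ m)%N -> (flip j n < 2 ^ m)%N.
Proof. by move=> jm nm; apply: lxor_lt => //; rewrite ltn_exp2l. Qed.

(** Otherwise n, flip j n and hence their bitwise sum 2 ^ j would all be below
2 ^ j. *)
Lemma flip_ge j n : (n < 2 ^ j)%N -> (2 ^ j <= flip j n)%N.
Proof.
move=> nj; rewrite leqNgt; apply/negP => h.
have := lxor_lt nj h; rewrite /flip -PeanoNat.Nat.lxor_assoc.
by rewrite PeanoNat.Nat.lxor_nilpotent PeanoNat.Nat.lxor_0_l ltnn.
Qed.

(** The flip of a digit below m permutes [0, 2 ^ m). *)
Lemma sum_flip (V : nmodType) j m (F : nat -> V) : (j < m)%N ->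
  \sum_(k < 2 ^ m) F (flip j k) = \sum_(k < 2 ^ m) F k.
Proof.
move=> jm; pose h (k : 'I_(2 ^ m)) := Ordinal (flip_lt jm (ltn_ord k)).
rewrite [RHS](reindex_inj (h := h)) //.
by move=> k l /(congr1 val) /= /(inv_inj (@flipK j)) /val_inj.
Qed.

End BitFlip.

Section Ell2Projections.
Variable R : realType.
Local Notation C := R[i].
Local Notation ell2 := (ell2 R).
Implicit Types f g h : ell2.

Fact flipf_subproof j f : f \o flip j \in @sqsummable R.
Proof.
have [B hB] := sqsum_bound f; apply/asboolP; exists B => n.
pose m := maxn n j.+1.
apply: le_trans (hB (2 ^ m)%N).
rewrite -(sum_flip (j := j) (fun k => rdot (f k) (f k))) ?leq_maxr //.
rewrite -!(big_mkord xpredT (fun k => rdot (f (flip j k)) (f (flip j k)))).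
have nm : (n <= 2 ^ m)%N by rewrite (leq_trans (leq_maxl n j.+1)) // ltnW // ltn_expl.
rewrite [leRHS](big_cat_nat _ (n := n)) //= lerDl.
by apply: sumr_ge0 => k _; apply: rdot_ge0.
Qed.

Definition flipf j f : ell2 := Ell2 (flipf_subproof j f).

Lemma flipfE j f k : flipf j f k = f (flip j k). Proof. by []. Qed.

Lemma expn2_cvg : (2 ^ m)%N @[m --> \oo] --> \oo.
Proof.
move=> A [N _ hN]; exists N => // m /= Nm; apply: hN => /=.
by rewrite (leq_trans Nm) // ltnW // ltn_expl.
Qed.

(** The partial sums up to 2 ^ m, for m > j, agree on both sides. *)
Lemma ip_flip j f g : ip (flipf j f) g = ip f (flipf j g).
Proof.
have h f1 g1 : series (fun k => rdot (f1 k) (g1 k)) (2 ^ m)%N @[m --> \oo]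
    --> ip f1 g1.
  by apply: (cvg_comp _ _ expn2_cvg); apply: ip_cvg.
have := h (flipf j f) g; have := h f (flipf j g).
set u := (X in X --> _ -> _); set v := (X in _ -> X --> _ -> _) => hu hv.
apply: (cvg_unique (@norm_hausdorff R R^o) hv).
apply: cvg_trans hu; apply: near_eq_cvg.
exists j.+1 => // m /= jm; rewrite /series /= !big_mkord.
rewrite -(sum_flip (j := j) (fun k => rdot (flipf j f k) (g k))) //.
by apply: eq_bigr => k _; rewrite !flipfE flipK.
Qed.

Lemma flipfZ j a f : flipf j (a *: f) = a *: flipf j f.
Proof. by apply: ell2_inj. Qed.

Lemma dotC_flip j f g : dotC (flipf j f) g = dotC f (flipf j g).
Proof. by rewrite /dotC !ip_flip flipfZ. Qed.

(** The spectral projection of the involution flipf j for the eigenvalue -1. *)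
Definition eproj j f : ell2 := 2^-1 *: (f - flipf j f).

Lemma eproj_lin j : linear (eproj j).
Proof.
move=> a f g; apply: ell2_inj => k.
rewrite /eproj !(ell2ZE, ell2DE, ell2NE, flipfE).
ring.
Qed.

HB.instance Definition _ j :=
  GRing.isLinear.Build C ell2 ell2 _ (eproj j) (eproj_lin j).

Lemma eprojE j f k : eproj j f k = 2^-1 * (f k - f (flip j k)).
Proof. by []. Qed.

Lemma eproj_idem j f : eproj j (eproj j f) = eproj j f.
Proof. by apply: ell2_inj => k; rewrite !eprojE flipK; field. Qed.

Lemma eproj_comm i j f : eproj i (eproj j f) = eproj j (eproj i f).
Proof. by apply: ell2_inj => k; rewrite !eprojE flip_comm; ring. Qed.

Local Notation H := (ell2_hilbert R).
Local Notation "''[' x , y ]" := (hdot H x y).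

Lemma hdot_flip j (f g : H) : '[flipf j f, g] = '[f, flipf j g].
Proof. exact: dotC_flip. Qed.

Lemma eproj_sa j (f g : H) : '[eproj j f, g] = '[f, eproj j g].
Proof.
rewrite (hdotZl 2^-1 (f - (flipf j f : H)) g) (hdotZr 2^-1 f (g - (flipf j g : H))).
by rewrite hdotBl hdotBr hdot_flip fmorphV rmorph_nat.
Qed.

Definition eprojs : projFamily H :=
  @ProjFamily R H (fun j => eproj j : {linear ell2 -> ell2})
    eproj_idem eproj_sa eproj_comm.

Definition supp n f := forall k, (n <= k)%N -> f k = 0.

Lemma supp_le m n f : (m <= n)%N -> supp m f -> supp n f.
Proof. by move=> mn h k nk; apply: h; apply: leq_trans nk. Qed.

Lemma supp_trunc n f : supp n (trunc n f).
Proof. by move=> k nk; rewrite truncE ltnNge nk. Qed.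

(** The flip of digit j moves [0, 2 ^ j) off itself. *)
Lemma ip_supp_flip j f g : supp (2 ^ j) f -> supp (2 ^ j) g ->
  ip (flipf j f) g = 0.
Proof.
move=> sf sg; rewrite /ip (_ : (fun k => _) = fun=> 0).
  by rewrite (_ : series _ = fun=> 0) ?lim_cst //; apply/funext => n; apply: big1.
apply/funext => k; rewrite flipfE.
have [/flip_ge h|h] := ltnP k (2 ^ j); first by rewrite sf // rdot0l.
by rewrite sg // rdot0r.
Qed.

Lemma hdot_supp_flip j (f g : H) : supp (2 ^ j) f -> supp (2 ^ j) g ->
  '[flipf j f, g] = 0.
Proof.
move=> sf sg; rewrite [LHS](_ : _ = dotC (flipf j f) g) // /dotC.
rewrite !ip_supp_flip // => k kj.
by rewrite ell2ZE sg // mulr0.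
Qed.

Implicit Types t : nat -> R.

Lemma phase_stepE t j (f : H) : phase_step eprojs t j f =
  ((1 + circ (t j)) / 2) *: f + ((1 - circ (t j)) / 2) *: (flipf j f : H).
Proof.
apply: ell2_inj => k; move: (f : ell2) => f'.
change (f' k + (circ (t j) - 1) * (2^-1 * (f' k - f' (flip j k))) =
  (1 + circ (t j)) / 2 * f' k + (1 - circ (t j)) / 2 * f' (flip j k)).
by field.
Qed.

Lemma supp_phase_step t j (f : H) : supp (2 ^ j) f ->
  supp (2 ^ j.+1) (phase_step eprojs t j f).
Proof.
move=> sf k kj; rewrite phase_stepE.
change ((1 + circ (t j)) / 2 * (f : ell2) k +
  (1 - circ (t j)) / 2 * (f : ell2) (flip j k) = 0).
have jk : (2 ^ j <= k)%N by apply: leq_trans kj; rewrite leq_exp2l.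
rewrite !sf ?mulr0 ?addr0 // leqNgt; apply/negP => h.
have lt : (flip j k < 2 ^ j.+1)%N by apply: leq_trans h _; rewrite leq_exp2l.
by have := flip_lt (ltnSn j) lt; rewrite flipK ltnNge kj.
Qed.

Lemma hdot_phase_step t j (f g : H) : supp (2 ^ j) f -> supp (2 ^ j) g ->
  '[phase_step eprojs t j f, g] = (1 + circ (t j)) / 2 * '[f, g].
Proof.
move=> sf sg; rewrite phase_stepE hdotDl hdotZl hdotZl hdot_supp_flip //.
by rewrite mulr0 addr0.
Qed.

Lemma phase_part_trivial t m n (f : H) : (m <= n)%N ->
  (forall j, (m <= j < n)%N -> t j = 0) ->
  phase_part eprojs t n f = phase_part eprojs t m f.
Proof.
elim: n => [|n IH] mn t0; first by move: mn; rewrite leqn0 => /eqP ->.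
move: mn; rewrite leq_eqVlt => /predU1P[-> //|mn] /=.
rewrite phase_step0; last by rewrite t0 // -ltnS mn /=.
by apply: IH => // j /andP[mj jn]; apply: t0; rewrite mj ltnW.
Qed.

End Ell2Projections.
(** * Weak convergence to zero over long blocks *)

Section BlockPhases.
Variable R : realType.
Local Notation C := R[i].
Local Notation H := (ell2_hilbert R).
Local Notation E := (eprojs R).
Local Notation "''[' x , y ]" := (hdot H x y).

(** The angle th on the set of indices alpha = a intersected with [J, m), and 0
elsewhere; block_size is the cardinality of alpha. *)
Definition block_phase (J m : nat) (a : pred nat) (th : R) : nat -> R :=
  fun j => if (J <= j < m)%N && a j then th else 0.

Definition block_size (J m : nat) (a : pred nat) : nat :=
  (\sum_(J <= j < m | a j) 1)%N.

Lemma block_sizeS J n (a : pred nat) : (J <= n)%N ->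
  block_size J n.+1 a = (block_size J n a + a n)%N.
Proof.
move=> Jn; rewrite /block_size big_mkcond big_nat_recr //= -big_mkcond /=.
by case: (a n).
Qed.

Variables (J m : nat) (a : pred nat) (th : R).
Local Notation t := (block_phase J m a th).

Lemma block_phase_out j : ~~ (J <= j < m)%N -> t j = 0.
Proof. by rewrite /block_phase => /negbTE ->. Qed.

Lemma block_phase_summable : summable_phase t.
Proof.
apply: nondecreasing_is_cvgn.
  by apply/nondecreasing_seqP => n; rewrite seriesSr lerDl.
exists (\sum_(k < m) `|t k|) => _ [n _ <-]; rewrite /series /= big_mkord.
apply: (sum_finsupp (F := fun k => `|t k|)) => // k mk.
by rewrite block_phase_out ?normr0 // ltnNge mk andbF.
Qed.

Lemma block_phase_lim (f : H) : phase_lim E t f = phase_part E t m f.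
Proof.
have h := @phase_limP _ _ E _ block_phase_summable f.
apply: (H_cvg_unique h).
have hc : phase_part E t m f @[_ --> \oo] --> phase_part E t m f.
  exact: cvg_cst.
apply: cvg_trans hc; apply: (near_eq_cvg (F := \oo)); exists m => // n /= mn.
rewrite (phase_part_trivial _ mn) // => j /andP[mj _].
by rewrite block_phase_out // ltnNge mj andbF.
Qed.

(** Each factor with j in alpha is (1 + w)/2 + (1 - w)/2 Z_j, where w = circ th, and
it acts on a vector supported in [0, 2 ^ j).  There the term in Z_j is orthogonal
to g, so that only the scalar (1 + w)/2 remains in the matrix coefficient. *)
Lemma block_phase_part (f g : H) n : (J <= n <= m)%N ->
  supp (2 ^ J) f -> supp (2 ^ J) g ->
  supp (2 ^ n) (phase_part E t n f) /\
  '[phase_part E t n f, g] =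
    ((1 + circ th) / 2) ^+ block_size J n a * '[f, g].
Proof.
move=> + sf sg; elim: n => [|n IH].
  rewrite leqn0 => /andP[/eqP J0 _].
  by rewrite J0 in sf *; rewrite /block_size big_geq //= expr0 mul1r.
move=> /andP[]; rewrite leq_eqVlt => /predU1P[<- _|Jn nm].
  rewrite (@phase_part_trivial _ t 0) //; last first.
    by move=> j /andP[_ jJ]; rewrite block_phase_out // leqNgt jJ.
  by rewrite /block_size big_geq //= expr0 mul1r.
have [|sn en] := IH; first by rewrite -ltnS Jn ltnW.
split=> /=; first exact: supp_phase_step.
rewrite hdot_phase_step //; last by apply: supp_le sg; rewrite leq_exp2l.
rewrite en mulrA block_sizeS // /block_phase -(ltnS J) Jn nm /=.
case: (a n); first by rewrite addn1 exprS.
rewrite addn0 circ0 (_ : (1 + 1) / 2 = 1 :> C) ?mul1r //.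
by field.
Qed.

Lemma block_phase_hdot (f g : H) : (J <= m)%N ->
  supp (2 ^ J) f -> supp (2 ^ J) g ->
  '[phase_lim E t f, g] = ((1 + circ th) / 2) ^+ block_size J m a * '[f, g].
Proof.
move=> Jm sf sg; rewrite block_phase_lim.
by have [|_] := block_phase_part (n := m) _ sf sg; rewrite ?Jm ?leqnn.
Qed.

End BlockPhases.

Section BlockWeak.
Variable R : realType.
Local Notation C := R[i].
Local Notation H := (ell2_hilbert R).
Local Notation E := (eprojs R).
Local Notation "''[' x , y ]" := (hdot H x y).

Lemma trunc_approxH (f : H) (e : C) : 0 < e ->
  exists n (f' : H), supp (2 ^ n) f' /\ `|f - f'| < e.
Proof.
move=> e0; have eE : e = (complex.Re e)%:C by rewrite RRe_real // gtr0_real.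
have [|n hn] := @trunc_approx R f (complex.Re e).
  by rewrite -ltcR -eE.
exists n, (trunc n f); split; last by rewrite eE -ltcR in hn *.
by apply: (supp_le _ (supp_trunc f)); rewrite ltnW // ltn_expl.
Qed.

(** Replace x and y by vectors of finite support, for which block_phase_hdot gives the
factor ((1 + w)/2) ^ |alpha|. *)
Lemma block_phase_weak (th : R) : circ th != 1 -> forall (x y : H) (e : C),
  0 < e -> exists J0, forall J m a, (J0 <= J)%N -> (J <= m)%N ->
    (J <= block_size J m a)%N ->
    `|'[phase_lim E (block_phase J m a th) x, y]| < e.
Proof.
move=> w1 x y e e0.
set q := (1 + circ th) / 2.
have q1 : cabs q < 1 by apply: cabs_half_lt1 => //; exact: norm_circ.
have gt1 (z : C) : 0 <= z -> 0 < z + 1 by move=> z0; rewrite ltr_wpDl.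
have part (z : C) : 0 <= z -> 0 < e / 3 / (z + 1).
  by move=> z0; rewrite !divr_gt0 // gt1.
have bound (u z : C) : 0 <= u -> 0 <= z -> u < e / 3 / (z + 1) -> u * z <= e / 3.
  move=> u0 z0 h; apply: (@le_trans _ _ (u * (z + 1))).
    by rewrite ler_wpM2l // lerDl.
  by rewrite -ler_pdivlMr ?gt1 // ltW.
have [n1 [x' [sx hx]]] := trunc_approxH x (part _ (normr_ge0 y)).
have [n2 [y' [sy hy]]] := trunc_approxH y (part _ (normr_ge0 x')).
have p0 := part _ (mulr_ge0 (normr_ge0 x') (normr_ge0 y')).
have pE := esym (RRe_real (gtr0_real p0)).
have p0' : 0 < complex.Re (e / 3 / (`|x'| * `|y'| + 1)) by rewrite -ltcR -pE.
have := @cvg_expr R (cabs q).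
rewrite ger0_norm ?cabs_ge0 // => /(_ q1) /cvgrPdist_lt /(_ _ p0').
move=> [N _ hN].
exists (maxn N (maxn n1 n2)) => J m a; rewrite !geq_max => /andP[NJ /andP[n1J n2J]] Jm.
move=> JB; set t := block_phase J m a th.
have st : summable_phase t by apply: block_phase_summable.
apply: le_lt_trans (phase_hdot_approx E x y x' y' st) _.
have e3 : e = e / 3 + (e / 3 + e / 3) by field.
rewrite [ltRHS]e3; apply: ler_ltD; first exact: bound.
apply: ler_ltD; first by rewrite mulrC; exact: bound.
rewrite block_phase_hdot //; last 2 first.
- by apply: supp_le sx; rewrite leq_exp2l.
- by apply: supp_le sy; rewrite leq_exp2l.
rewrite normrM normrX cabsE -/q -rmorphXn.
have hJ : cabs q ^+ block_size J m a < complex.Re (e / 3 / (`|x'| * `|y'| + 1)).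
  have := hN (block_size J m a) (leq_trans NJ JB).
  by rewrite /= sub0r normrN ger0_norm // exprn_ge0 // cabs_ge0.
rewrite -ltcR -pE in hJ.
have h0 : 0 <= (cabs q ^+ block_size J m a)%:C.
  by rewrite lecR exprn_ge0 // cabs_ge0.
apply: (@le_lt_trans _ _ ((cabs q ^+ block_size J m a)%:C * (`|x'| * `|y'|))).
  by rewrite ler_wpM2l // hdot_CS.
apply: (@le_lt_trans _ _ ((cabs q ^+ block_size J m a)%:C * (`|x'| * `|y'| + 1))).
  by rewrite ler_wpM2l // lerDl.
by rewrite -ltr_pdivlMr // gt1 // mulr_ge0.
Qed.


End BlockWeak.
(** * Idempotent ultrafilters *)

Section IdempotentUltrafilters.
Implicit Types (p q r F : set_system posnat) (A B : set posnat).

Lemma filter_contra F A : ProperFilter F -> F A -> F (~` A) -> False.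
Proof.
by move=> FF FA /(filterI FA); rewrite setICr; exact: filter_not_empty.
Qed.

Lemma ultraP p : ProperFilter p -> (forall A, p A \/ p (~` A)) -> UltraFilter p.
Proof.
move=> pp h; split=> // G GG pG; apply/seteqP; split=> [A GA|//].
have [//|/pG GcA] := h A.
by case: (filter_contra GG GA GcA).
Qed.

Lemma ultra_eq p q : UltraFilter p -> ProperFilter q -> p `<=` q -> p = q.
Proof. by move=> pu qp pq; rewrite (max_filter _ pq). Qed.

Lemma ultra_add_filter p F : ProperFilter p -> ProperFilter F ->
  ProperFilter (ultra_add p F).
Proof.
move=> pp FF; split.
  move=> /=; rewrite /ultra_add /= => h.
  have [n /= pn] := filter_ex h.
  exact: (@filter_not_empty _ p _ pn).
split.
- by apply: filterS (@filterT _ F _) => n _ /=; apply: filterS (@filterT _ p _).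
- move=> A B; rewrite /ultra_add /= => hA hB.
  apply: filterS2 hA hB => n pA pB /=.
  by apply: filterS2 pA pB => y.
- move=> A B AB; rewrite /ultra_add /=; apply: filterS => n /=.
  by apply: filterS => y; apply: AB.
Qed.

Lemma ultra_add_ultra p q : UltraFilter p -> UltraFilter q ->
  UltraFilter (ultra_add p q).
Proof.
move=> pu qu; apply: ultraP; first exact: ultra_add_filter.
move=> A; have [h|h] := in_ultra_setVsetC [set n | p [set y | A (posnat_add y n)]] qu.
  by left.
right; apply: filterS h => n /= h.
by have [//|] := in_ultra_setVsetC [set y | A (posnat_add y n)] pu.
Qed.

Lemma ultra_addA p q r :
  ultra_add (ultra_add p q) r = ultra_add p (ultra_add q r).
Proof.
have addA (x y z : posnat) : posnat_add (posnat_add x y) z =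
    posnat_add x (posnat_add y z).
  by apply: val_inj; rewrite /= addnA.
apply/funext => A; rewrite /ultra_add /=.
congr (r _); apply/funext => n /=; congr (q _); apply/funext => m /=.
by congr (p _); apply/funext => y /=; rewrite addA.
Qed.

(** A filter is the intersection of the ultrafilters that contain it. *)
Lemma filter_ultra F A : ProperFilter F ->
  (forall q, UltraFilter q -> F `<=` q -> q A) -> F A.
Proof.
move=> FF h; apply: contrapT => nFA.
pose G := [set B | exists2 D, F D & D `&` ~` A `<=` B].
have GG : ProperFilter G.
  split.
    move=> [D FD DA]; apply: nFA; apply: filterS FD => x Dx.
    by apply: contrapT => nAx; apply: (DA x).
  split.
  - by exists setT => //; apply: filterT.
  - move=> B C [D FD DB] [D' FD' DC]; exists (D `&` D'); first exact: filterI.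
    by move=> x [[Dx D'x] nAx]; split; [apply: DB|apply: DC].
  - by move=> B C BC [D FD DB]; exists D => // x /DB /BC.
have [q [qu Gq]] := ultraFilterLemma GG.
have qcA : q (~` A) by apply: Gq; exists setT; [exact: filterT|move=> x []].
have qA : q A by apply: h => // D FD; apply: Gq; exists D => // x [].
exact: (filter_contra (@ultra_proper _ _ qu) qA qcA).
Qed.

(** The closed subsets of the space of ultrafilters are the sets of ultrafilters that
contain a given filter F; this says that the closed set of F is a semigroup.  A
larger filter is a smaller closed set. *)
Definition closed_semigroup F := ProperFilter F /\
  forall p q, UltraFilter p -> UltraFilter q -> F `<=` p -> F `<=` q ->
    F `<=` ultra_add p q.

(** The closed set of the ultrafilters q above F such that p + q = r. *)
Definition shift_filter p r F :=
  [set B | exists A D, [/\ r A, F D &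
     [set n | p [set y | A (posnat_add y n)]] `&` D `<=` B]].

(** If A in r had shifts that avoid some D in F, then the complement of A would be in
p + F, hence in r. *)
Lemma shift_filter_proper p r F : UltraFilter p -> UltraFilter r ->
  ProperFilter F -> ultra_add p F `<=` r -> ProperFilter (shift_filter p r F).
Proof.
move=> pu ru FF Fr; split.
  move=> [A [D [rA FD AD]]].
  have : r (~` A).
    apply: Fr; rewrite /ultra_add /=; apply: filterS FD => n Dn /=.
    have [h|//] := in_ultra_setVsetC [set y | A (posnat_add y n)] pu.
    by case: (AD n).
  exact: (filter_contra (@ultra_proper _ _ ru) rA).
split.
- by exists setT, setT; split=> //; apply: filterT.
- move=> B C [A [D [rA FD AD]]] [A' [D' [rA' FD' AD']]].
  exists (A `&` A'), (D `&` D'); split; [exact: filterI..|].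
  move=> n [/= h [Dn D'n]]; split; [apply: AD|apply: AD']; split=> //=.
    by apply: filterS h => y [].
  by apply: filterS h => y [].
- by move=> B C BC [A [D [rA FD AD]]]; exists A, D; split=> // x /AD /BC.
Qed.

Lemma shift_filterP p r F q : UltraFilter p -> UltraFilter r ->
  ProperFilter F -> UltraFilter q -> shift_filter p r F `<=` q ->
  F `<=` q /\ ultra_add p q = r.
Proof.
move=> pu ru FF qu h; split.
  by move=> D FD; apply: h; exists setT, D; split; [exact: filterT|exact: FD|move=> x []].
apply/esym; apply: ultra_eq; first exact: (@ultra_proper _ _ (ultra_add_ultra pu qu)).
by move=> A rA; apply: h; exists A, setT; split; [exact: rA|exact: filterT|move=> x []].
Qed.

(** The filter p + F has for closed set the sums p + q with q above F, and
(p + q) + (p + q') = p + (q + (p + q')). *)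
Lemma closed_semigroup_shift F p : closed_semigroup F -> UltraFilter p ->
  F `<=` p -> closed_semigroup (ultra_add p F).
Proof.
move=> [FF Fadd] pu Fp; split; first exact: ultra_add_filter.
have lift r : UltraFilter r -> ultra_add p F `<=` r ->
    exists q, [/\ UltraFilter q, F `<=` q & ultra_add p q = r].
  move=> ru Fr.
  have [q [qu hq]] := ultraFilterLemma (shift_filter_proper pu ru FF Fr).
  by have [Fq pq] := shift_filterP pu ru FF qu hq; exists q.
move=> r1 r2 r1u r2u /(lift _ r1u)[q1 [q1u Fq1 <-]] /(lift _ r2u)[q2 [q2u Fq2 <-]].
move=> A; rewrite ultra_addA.
have Fpq : F `<=` ultra_add p q2 by apply: (Fadd p q2).
exact: (Fadd q1 _ q1u (ultra_add_ultra pu q2u)).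
Qed.

(** Ellis's argument in a minimal closed semigroup S: p + S is a closed subsemigroup of
S, hence S, so that p = p + q for some q; the q in S with p + q = p form a closed
subsemigroup, hence S, and p is one of them. *)
Lemma maximal_semigroup_idempotent F p : closed_semigroup F ->
  (forall G, closed_semigroup G -> F `<=` G -> G = F) ->
  UltraFilter p -> F `<=` p -> ultra_add p p = p.
Proof.
move=> [FF Fadd] Fmax pu Fp.
have FpF : ultra_add p F = F.
  apply: Fmax; first exact: (closed_semigroup_shift (conj FF Fadd) pu Fp).
  by move=> A FA; apply: (@filter_ultra F) => q qu Fq; apply: (Fadd p q).
have pF : ultra_add p F `<=` p by rewrite FpF.
have sF : shift_filter p p F = F.
  apply: Fmax; last first.
    by move=> D FD; exists setT, D; split; [exact: filterT|exact: FD|move=> x []].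
  split; first exact: shift_filter_proper.
  move=> q1 q2 q1u q2u /(shift_filterP pu pu FF q1u)[Fq1 pq1].
  move=> /(shift_filterP pu pu FF q2u)[Fq2 pq2] B [A [D [pA FD AD]]].
  have qq : ProperFilter (ultra_add q1 q2) by exact: ultra_add_filter.
  apply: filterS AD _; apply: filterI; last exact: Fadd FD.
  by change (ultra_add p (ultra_add q1 q2) A); rewrite -ultra_addA pq1 pq2.
by have [] := shift_filterP pu pu FF pu; rewrite ?sF.
Qed.

Lemma closed_semigroup_idempotent F : closed_semigroup F ->
  exists p, idempotent_ultrafilter p /\ F `<=` p.
Proof.
(* The empty set stands for the union of the empty chain. *)
move=> Fs; pose P G := G = set0 \/ (closed_semigroup G /\ F `<=` G).
have [M [PM Mmax]] : exists M, P M /\ forall G, M `<` G -> ~ P G.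
  apply: Zorn_bigcup => K KP Ktot.
  have [[G [KG Gs FG]]|nK] :=
      pselect (exists G, [/\ K G, closed_semigroup G & F `<=` G]); last first.
    left; apply/seteqP; split=> // A [G KG GA]; case: (KP G KG) => [G0|[Gs FG]].
      by rewrite -G0.
    by case: nK; exists G.
  right; split; last by move=> A FA; exists G => //; apply: FG.
  have KF X A : K X -> X A -> ProperFilter X.
    by move=> KX XA; case: (KP X KX) => [X0|[[]]//]; rewrite X0 in XA.
  split.
    split.
      by move=> [X KX X0]; have Xf := KF _ _ KX X0; exact: (@filter_not_empty _ X _ X0).
    split.
    - by exists G => //; have GF := Gs.1; exact: filterT.
    - move=> A B [X KX XA] [Y KY YB]; have Xf := KF _ _ KX XA.
      have Yf := KF _ _ KY YB.
      by case: (Ktot X Y KX KY) => XY; [exists Y|exists X] => //;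
        apply: filterI => //; apply: XY.
    - move=> A B AB [X KX XA]; have Xf := KF _ _ KX XA.
      by exists X => //; apply: filterS XA.
  move=> p q pu qu Kp Kq A [X KX XA].
  case: (KP X KX) => [X0|[[_ Xadd] _]]; first by rewrite X0 in XA.
  by apply: Xadd XA => // B XB; [apply: Kp|apply: Kq]; exists X.
have [M0|[Ms FM]] := PM.
  have FF := Fs.1.
  have MF : M `<` F.
    rewrite M0; split; first by move=> A [].
    by move=> h; have [] := h setT (@filterT _ F _).
  by exfalso; apply: (Mmax F MF); right; split.
have Mmax' G : closed_semigroup G -> M `<=` G -> G = M.
  move=> Gs MG; apply: contrapT => GM; apply: (Mmax G).
    by split=> // GsubM; apply: GM; apply/seteqP.
  by right; split=> //; apply: subset_trans MG.
have [p [pu Mp]] := ultraFilterLemma Ms.1.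
exists p; split; last exact: subset_trans Mp.
by split=> //; apply: maximal_semigroup_idempotent Mp.
Qed.

Lemma idempotent_extending F : ProperFilter F ->
  (forall A, F A -> ultra_add F F A) ->
  exists p, idempotent_ultrafilter p /\ F `<=` p.
Proof.
move=> FF h; apply: closed_semigroup_idempotent; split=> // p q pu qu Fp Fq A FA.
apply: filterS (Fq _ (h A FA)) => n /=; exact: Fp.
Qed.

End IdempotentUltrafilters.
(** * Polynomial values and angles modulo one *)

Section Lacunary.

(** The two divisibility conditions make cross terms integral; the growth condition,
relative to the sum of the earlier terms, makes the other ones summable. *)
Definition lacunary (N M : nat) (n : nat -> nat) : Prop :=
  [/\ forall j, (0 < n j)%N, forall j, (M %| n j)%N,
      forall i j, (i < j)%N -> (M * n i ^ N %| n j)%N &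
      forall j, (2 ^ j * (\sum_(i < j) n i).+1 ^ N <= n j)%N].

(** Powers of 2M with exponents that grow geometrically: n_j = (2M) ^ (N+2) ^ (j+2). *)
Lemma lacunary_exists N M : (0 < M)%N -> exists n, lacunary N M n.
Proof.
move=> M0; pose b := (2 * M)%N; pose e j := (N.+2 ^ j.+1)%N.
have b1 : (1 < b)%N by rewrite /b; lia.
have b0 : (0 < b)%N by apply: ltnW.
have Mb : (M %| b)%N by rewrite dvdn_mull.
have e0 j : (0 < e j)%N by rewrite expn_gt0.
have eS j : e j.+1 = (N * e j + 2 * e j)%N by rewrite /e expnS -addn2 mulnDl.
have ele i j : (i <= j)%N -> (e i <= e j)%N by move=> ij; rewrite leq_exp2l.
exists (fun j => b ^ e j.+1)%N; split.
- by move=> j; rewrite expn_gt0 b0.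
- by move=> j; rewrite -(prednK (e0 j.+1)) expnS dvdn_mulr.
- move=> i j ij; have h := ele i.+2 j.+1 ij.
  rewrite -expnM -(subnKC h) expnD; apply: dvdn_mulr.
  rewrite (eS i.+1) expnD mulnC [(N * _)%N]mulnC; apply: dvdn_mul => //.
  by rewrite (dvdn_trans Mb) // -[X in (X %| _)%N]expn1 dvdn_exp2l // muln_gt0 e0.
have sum_le j : ((\sum_(i < j) b ^ e i.+1).+1 <= b ^ (e j).+1)%N.
  elim: j => [|j IH]; first by rewrite big_ord0 expn_gt0 b0.
  rewrite big_ord_recr /= -addSn.
  apply: leq_trans (leq_add IH (leqnn _)) _.
  have h : (b ^ (e j).+1 <= b ^ e j.+1)%N.
    by rewrite leq_exp2l // eS; have := e0 j; nia.
  apply: leq_trans (leq_add h (leqnn _)) _.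
  by rewrite addnn -mul2n expnS leq_mul2r b1 orbT.
have mono x y k : (x <= y)%N -> (x ^ k <= y ^ k)%N.
  by move=> xy; elim: k => // k IH; rewrite !expnS leq_mul.
move=> j; apply: (@leq_trans (b ^ j * (b ^ (e j).+1) ^ N)%N).
  by apply: leq_mul; apply: mono.
rewrite -expnM -expnD leq_exp2l // eS.
have jej : (j < e j)%N.
  by apply: leq_trans (ltnW (ltn_expl j.+1 (ltnSn 1))) _; apply: mono.
have Nej : (N.+2 <= e j)%N by rewrite -[X in (X <= _)%N]expn1 leq_exp2l.
by nia.
Qed.

End Lacunary.

Section ModOne.
Variable R : realType.
Implicit Types x y d : R.

(** Equality modulo 1 up to the error d. *)
Definition near_mod1 x y d := exists z : int, `|x - y - z%:~R| <= d.

Lemma near_mod1_refl x : near_mod1 x x 0.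
Proof. by exists 0; rewrite subrr subr0 normr0. Qed.

Lemma near_mod1_le x y d d' : d <= d' -> near_mod1 x y d -> near_mod1 x y d'.
Proof. by move=> dd [z hz]; exists z; apply: le_trans dd. Qed.

Lemma near_mod1_int (k : int) : near_mod1 k%:~R 0 0.
Proof. by exists k; rewrite subr0 subrr normr0. Qed.

Lemma near_mod1D x y d x' y' d' : near_mod1 x y d -> near_mod1 x' y' d' ->
  near_mod1 (x + x') (y + y') (d + d').
Proof.
move=> [z hz] [z' hz']; exists (z + z'); rewrite rmorphD /=.
rewrite (_ : _ - _ = (x - y - z%:~R) + (x' - y' - z'%:~R)); last by ring.
by apply: le_trans (ler_normD _ _) _; apply: lerD.
Qed.

Lemma near_mod1_sum I (r : seq I) (P : pred I) (F G D : I -> R) :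
  (forall i, P i -> near_mod1 (F i) (G i) (D i)) ->
  near_mod1 (\sum_(i <- r | P i) F i) (\sum_(i <- r | P i) G i)
    (\sum_(i <- r | P i) D i).
Proof.
move=> h; elim: r => [|i r IH]; first by rewrite !big_nil; apply: near_mod1_refl.
by rewrite !big_cons; case: ifP => // /h hi; apply: near_mod1D.
Qed.

Lemma near_mod1_mulz (k : int) x y d : near_mod1 x y d ->
  near_mod1 (k%:~R * x) (k%:~R * y) (`|k|%:~R * d).
Proof.
move=> [z hz]; exists (k * z); rewrite rmorphM /= -!mulrBr normrM.
by rewrite intr_norm ler_wpM2l.
Qed.

Lemma near_mod1_trans_int x y y' d (k : int) : y = y' + k%:~R ->
  near_mod1 x y d -> near_mod1 x y' d.
Proof.
move=> -> [z hz]; exists (k + z); rewrite rmorphD /=.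
by rewrite (_ : _ - _ = x - (y' + k%:~R) - z%:~R) //; ring.
Qed.

End ModOne.
Section RotationAngles.
Variables (R : realType) (N M : nat) (n : nat -> nat) (c : nat -> int).
Hypotheses (M0 : (0 < M)%N) (nlac : lacunary N M n) (c0 : c 0%N = 0).
Implicit Types (Q : {poly int}) (j k d e A : nat).

(** Chosen so that n_j ^ k tau_j is c_k / M modulo 1, for all k <= N, up to O(1/n_j):
the terms with d < k are integers because M divides n_j, and those with d > k are
small. *)
Definition tau j : R :=
  \sum_(d < N.+1) (c d)%:~R / (M%:R * (n j)%:R ^+ d).

Definition csum : R := \sum_(d < N.+1) `|c d|%:~R.

Definition weight Q : int := \sum_(d < N.+1) Q`_d * c d.

Definition coef_norm Q : R := \sum_(d < N.+1) `|Q`_d|%:~R.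

Let MR : M%:R != 0 :> R. Proof. by rewrite pnatr_eq0 -lt0n. Qed.
Let n0 j : (0 < n j)%N. Proof. by case: nlac. Qed.
Let nR j : (n j)%:R != 0 :> R. Proof. by rewrite pnatr_eq0 -lt0n. Qed.
Let n1 j : 1 <= (n j)%:R :> R. Proof. by rewrite ler1n. Qed.
Let M1 : 1 <= M%:R :> R. Proof. by rewrite ler1n. Qed.

Lemma csum_ge0 : 0 <= csum.
Proof. by apply: sumr_ge0 => d _; rewrite ler0z. Qed.

Lemma coef_norm_ge0 Q : 0 <= coef_norm Q.
Proof. by apply: sumr_ge0 => d _; rewrite ler0z. Qed.

Lemma angle_term_small j d k : (k < d)%N ->
  `|(n j)%:R ^+ k * ((c d)%:~R / (M%:R * (n j)%:R ^+ d))| <=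
  `|c d|%:~R / (n j)%:R :> R.
Proof.
move=> kd; rewrite (_ : _ * _ = (c d)%:~R / (n j)%:R *
    (M%:R * (n j)%:R ^+ (d - k.+1))^-1); last first.
  have -> : (n j)%:R ^+ d = (n j)%:R ^+ k * (n j)%:R * (n j)%:R ^+ (d - k.+1) :> R.
    by rewrite -exprSr -exprD subnKC.
  have nk : (n j)%:R ^+ k != 0 :> R by rewrite expf_neq0.
  have nd : (n j)%:R ^+ (d - k.+1) != 0 :> R by rewrite expf_neq0.
  by field; rewrite MR nR nk nd.
rewrite normrM normf_div normr_nat -intr_norm ler_piMr //.
  by rewrite divr_ge0 // ler0z.
rewrite ger0_norm ?invr_ge0 ?mulr_ge0 ?exprn_ge0 //.
by rewrite invf_le1 ?mulr_ege1 ?exprn_ege1 // mulr_gt0 ?ltr0n // exprn_gt0 // ltr0n.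
Qed.

(** The term of index 0 vanishes because c 0 = 0. *)
Lemma tau_small j : `|tau j| <= csum / (n j)%:R.
Proof.
rewrite /csum mulr_suml; apply: le_trans (ler_norm_sum _ _ _) _.
apply: ler_sum => -[[|d] hd] _ /=.
  by rewrite c0 normr0 !mul0r normr0.
by have := angle_term_small j (ltn0Sn d); rewrite expr0 mul1r.
Qed.

Lemma tau_den j : exists k : int, (M * n j ^ N)%:R * tau j = k%:~R.
Proof.
exists (\sum_(d < N.+1) (n j)%:Z ^+ (N - d) * c d).
rewrite /tau mulr_sumr rmorph_sum /=; apply: eq_bigr => d _.
have dN : (d <= N)%N by rewrite -ltnS.
rewrite natrM natrX [RHS]intrM [in RHS]rmorphXn /=.
have -> : (n j)%:R ^+ N = (n j)%:R ^+ d * (n j)%:R ^+ (N - d) :> R.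
  by rewrite -exprD subnKC.
have nd : (n j)%:R ^+ d != 0 :> R by rewrite expf_neq0.
rewrite -pmulrn; move: ((n j)%:R ^+ (N - d)) ((n j)%:R ^+ d) nd => u v nd.
by field; rewrite MR nd.
Qed.

Lemma pow_tau j k : (k <= N)%N ->
  near_mod1 ((n j)%:R ^+ k * tau j) ((c k)%:~R / M%:R) (csum / (n j)%:R).
Proof.
move=> kN; have hk : (k < N.+1)%N by [].
rewrite /tau mulr_sumr /csum mulr_suml.
rewrite (_ : (c k)%:~R / M%:R = \sum_(d < N.+1)
    (if d == Ordinal hk then (c k)%:~R / M%:R else 0)); last first.
  by rewrite -big_mkcond big_pred1_eq.
apply: near_mod1_sum => d _.
have [->|dk] := eqVneq d (Ordinal hk).
  have nk : (n j)%:R ^+ k != 0 :> R by rewrite expf_neq0.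
  have -> : (n j)%:R ^+ k * ((c k)%:~R / (M%:R * (n j)%:R ^+ k)) =
      (c k)%:~R / M%:R :> R by field; rewrite MR nk.
  by apply: near_mod1_le (near_mod1_refl _); rewrite divr_ge0 // ler0z.
have {}dk : (d : nat) != k by apply: contra dk => /eqP dk; apply/eqP/val_inj.
have [kd|dk'|e] := ltngtP k d; last by rewrite e eqxx in dk.
  by exists 0; rewrite !subr0; apply: angle_term_small.
rewrite [X in near_mod1 X](_ : _ =
    ((n j %/ M)%N%:Z * (n j)%:Z ^+ (k - d.+1) * c d)%:~R).
  by apply: near_mod1_le (near_mod1_int _ _); rewrite divr_ge0 // ler0z.
rewrite !intrM [in RHS]rmorphXn /=.
have nM : (n j)%:R = M%:R * (n j %/ M)%:R :> R.
  by case: nlac => _ Mn _ _; rewrite -natrM mulnC divnK.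
have -> : (n j)%:R ^+ k = (n j)%:R ^+ d * (n j)%:R * (n j)%:R ^+ (k - d.+1) :> R.
  by rewrite -exprSr -exprD subnKC.
have nd : (n j)%:R ^+ d != 0 :> R by rewrite expf_neq0.
rewrite -!pmulrn; move: nd; move: ((n j)%:R ^+ (k - d.+1)) ((n j)%:R ^+ d) => u v nd.
by rewrite [in LHS]nM; field; rewrite MR nd.
Qed.

(** In the binomial expansion of (A + n_j) ^ e, all the terms except n_j ^ e carry a
factor A, which cancels the denominator M. *)
Lemma shift_pow_tau j A e : (e <= N)%N -> (M %| A)%N ->
  near_mod1 ((A + n j)%:R ^+ e * tau j) ((c e)%:~R / M%:R)
    ((1 + A%:R) ^+ e * (csum / (n j)%:R)).
Proof.
move=> eN MA.
rewrite natrD exprDn mulr_suml (addrC 1) exprDn mulr_suml.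
rewrite (_ : (c e)%:~R / M%:R = \sum_(k < e.+1)
    (if k == ord_max then (c e)%:~R / M%:R else 0)); last first.
  by rewrite -big_mkcond big_pred1_eq.
apply: near_mod1_sum => k _; rewrite expr1n mulr1.
have ke : (k <= e)%N by rewrite -ltnS.
have h := near_mod1_mulz (A%:Z ^+ (e - k) *+ 'C(e, k)) (pow_tau j (leq_trans ke eN)).
have E1 : (A%:Z ^+ (e - k) *+ 'C(e, k))%:~R = A%:R ^+ (e - k) *+ 'C(e, k) :> R.
  by rewrite rmorphMn rmorphXn.
have E2 : `|A%:Z ^+ (e - k) *+ 'C(e, k)|%:~R = A%:R ^+ (e - k) *+ 'C(e, k) :> R.
  by rewrite ger0_norm ?E1 // mulrn_wge0 // exprn_ge0.
rewrite E1 E2 in h.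
rewrite [X in near_mod1 X](_ : _ = A%:R ^+ (e - k) *+ 'C(e, k) * ((n j)%:R ^+ k * tau j)); last first.
  by rewrite mulrA mulrnAl.
have [kmax|kmax] := eqVneq k ord_max.
  move: h; rewrite kmax /= subnn expr0 binn mulr1n !mul1r.
  exact.
have {}kmax : (k < e)%N.
  rewrite ltn_neqAle ke andbT; apply: contra kmax => /eqP h'.
  by apply/eqP/val_inj.
pose q : int := (A %/ M)%N%:Z * A%:Z ^+ (e - k.+1) * ('C(e, k))%:Z * c k.
apply: (near_mod1_trans_int (k := q)) h.
rewrite add0r /q !intrM [in RHS]rmorphXn /= -!pmulrn.
have AM : A%:R = M%:R * (A %/ M)%:R :> R by rewrite -natrM mulnC divnK.
have -> : A%:R ^+ (e - k) = A%:R * A%:R ^+ (e - k.+1) :> R.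
  by rewrite -exprS subnSK.
rewrite -mulr_natr; move: (A%:R ^+ (e - k.+1)) => u.
by rewrite [in LHS]AM; field.
Qed.

Lemma horner_sum Q (x : int) : polyN N Q ->
  (Q.[x])%:~R = \sum_(e < N.+1) (Q`_e)%:~R * x%:~R ^+ e :> R.
Proof.
move=> [_ sQ]; rewrite (horner_coef_wide _ sQ) rmorph_sum /=.
by apply: eq_bigr => e _; rewrite intrM rmorphXn.
Qed.

Lemma coef_bound Q A : \sum_(e < N.+1) `|Q`_e|%:~R * (1 + A%:R) ^+ e <=
  coef_norm Q * (1 + A%:R) ^+ N :> R.
Proof.
rewrite /coef_norm mulr_suml; apply: ler_sum => e _.
by apply: ler_wpM2l; rewrite ?ler0z // ler_weXn2l ?lerDl // -ltnS.
Qed.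

Lemma horner_inside Q j A : polyN N Q -> (M %| A)%N ->
  near_mod1 ((Q.[(A + n j)%:Z])%:~R * tau j) ((weight Q)%:~R / M%:R)
    (coef_norm Q * (1 + A%:R) ^+ N * (csum / (n j)%:R)).
Proof.
move=> hQ MA; rewrite horner_sum // mulr_suml.
have -> : (weight Q)%:~R / M%:R =
    \sum_(e < N.+1) (Q`_e)%:~R * ((c e)%:~R / M%:R) :> R.
  rewrite /weight rmorph_sum /= mulr_suml; apply: eq_bigr => e _.
  by rewrite intrM mulrA.
apply: (@near_mod1_le _ _ _ (\sum_(e < N.+1) `|Q`_e|%:~R *
    ((1 + A%:R) ^+ e * (csum / (n j)%:R)))).
  rewrite (_ : \sum_(e < N.+1) _ = (\sum_(e < N.+1)
      `|Q`_e|%:~R * (1 + A%:R) ^+ e) * (csum / (n j)%:R)); last first.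
    by rewrite [RHS]mulr_suml; apply: eq_bigr => e _; rewrite -!mulrA.
  by apply: ler_wpM2r (coef_bound Q A); rewrite divr_ge0 // csum_ge0.
apply: near_mod1_sum => e _; rewrite -mulrA.
by apply: near_mod1_mulz; apply: shift_pow_tau => //; rewrite -ltnS.
Qed.

Lemma horner_outside Q j A : polyN N Q ->
  `|(Q.[A%:Z])%:~R * tau j| <=
    coef_norm Q * (1 + A%:R) ^+ N * (csum / (n j)%:R).
Proof.
move=> hQ; rewrite normrM; apply: ler_pM => //; last exact: tau_small.
apply: le_trans (coef_bound Q A); rewrite horner_sum //.
apply: le_trans (ler_norm_sum _ _ _) _; apply: ler_sum => e _.
rewrite normrM -intr_norm normrX; apply: ler_wpM2l; first by rewrite ler0z.
by rewrite normr_nat lerXn2r ?nnegrE ?addr_ge0 // lerDr.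
Qed.

Definition ipsum (J m : nat) (a : pred nat) : nat :=
  (\sum_(J <= j < m | a j) n j)%N.

Lemma horner_shift Q (x b : int) : exists k : int, Q.[x + b] = Q.[x] + k * b.
Proof.
have /factor_theorem[q qE] : root (Q - (Q.[x])%:P) x.
  by rewrite rootE !hornerE subrr.
exists q.[x + b].
have := congr1 (horner^~ (x + b)) qE.
rewrite !(hornerD, hornerN, hornerC, hornerX, hornerM) [X in _ * X]addrC addKr.
by move=> <-; rewrite addrCA subrr addr0.
Qed.

(** A shift by a multiple of the denominator of tau_j does not change the angle
modulo 1. *)
Lemma horner_shift_tau Q j (x b : nat) : (M * n j ^ N %| b)%N ->
  exists k : int, (Q.[(x + b)%:Z])%:~R * tau j = (Q.[x%:Z])%:~R * tau j + k%:~R.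
Proof.
move=> /dvdnP[b' bE]; have [k kE] := horner_shift Q x%:Z b%:Z.
have [k' k'E] := tau_den j.
exists (k * b'%:Z * k'); rewrite PoszD kE intrD intrM mulrDl; congr (_ + _).
rewrite !intrM -k'E -!mulrA; congr (_ * _).
by rewrite mulrA -!pmulrn -natrM -bE.
Qed.

Lemma ipsum_dvd j J m a : (j < J)%N -> (M * n j ^ N %| ipsum J m a)%N.
Proof.
move=> jJ; rewrite /ipsum big_nat_cond; apply: dvdn_sum => i /andP[/andP[Ji _] _].
by case: nlac => _ _ h _; apply: h; apply: leq_trans Ji.
Qed.

Lemma ipsum_head j J m a : (M %| ipsum J m a)%N /\
  ((m <= j)%N -> (ipsum J m a <= \sum_(i < j) n i)%N).
Proof.
split; first by apply: dvdn_sum => i _; case: nlac.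
move=> mj; rewrite -(big_mkord xpredT n).
apply: (@leq_trans (\sum_(0 <= i < m) n i)%N); last first.
  by rewrite [leqRHS](big_cat_nat _ (n := m)) //= leq_addr.
rewrite /ipsum big_mkcond /=; have [Jm|mJ] := leqP J m; last first.
  by rewrite big_geq // ltnW.
rewrite [leqRHS](big_cat_nat _ (n := J)) //=; apply: leq_trans (leq_addl _ _).
by apply: leq_sum => i _; case: ifP.
Qed.

Lemma ipsum_cat J k m a : (J <= k <= m)%N ->
  ipsum J m a = (ipsum J k a + ipsum k m a)%N.
Proof. by move=> /andP[Jk km]; rewrite /ipsum (big_cat_nat _ (n := k)). Qed.

Lemma ipsum_ltn k m a : (k < m)%N ->
  ipsum k m a = ((if a k then n k else 0) + ipsum k.+1 m a)%N.
Proof.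
by move=> km; rewrite /ipsum big_ltn_cond //; case: ifP.
Qed.

(** The growth condition of lacunary, stated for the errors of horner_inside and
horner_outside. *)
Lemma lacunary_bound j A : (A <= \sum_(i < j) n i)%N ->
  (1 + A%:R) ^+ N * (csum / (n j)%:R) <= csum * 2^-1 ^+ j :> R.
Proof.
move=> AS; rewrite mulrCA; apply: ler_wpM2l; first exact: csum_ge0.
have nj : 0 < (n j)%:R :> R by rewrite ltr0n.
rewrite ler_pdivrMr // exprVn mulrC ler_pdivlMr ?exprn_gt0 //.
rewrite -natrX addrC natr1 -natrX -natrM ler_nat mulnC.
case: nlac => _ _ _ /(_ j); apply: leq_trans.
rewrite leq_mul2l; apply/orP; right.
by case: (N) => // N'; rewrite leq_exp2r.
Qed.

(** For an index j >= J, split the sum at j.  The later terms are multiples of the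
denominator of tau_j and may be dropped; the earlier ones have sum A, a multiple
of M, small compared with n_j.  There remains Q(A + n_j) tau_j or Q(A) tau_j,
according to whether j is one of the indices.  For j < J, the whole sum is a
multiple of the denominator and Q has no constant term. *)
Lemma horner_ipsum Q J m a : polyN N Q -> (J <= m)%N -> forall j,
  near_mod1 ((Q.[(ipsum J m a)%:Z])%:~R * tau j)
    (block_phase J m a ((weight Q)%:~R / M%:R) j)
    (if (J <= j)%N then coef_norm Q * csum * 2^-1 ^+ j else 0).
Proof.
move=> hQ Jm j; rewrite /block_phase.
case: (leqP J j) => [Jj|jJ] /=; last first.
  have [k] := horner_shift_tau Q 0 (ipsum_dvd m a jJ).
  by rewrite add0n hQ.1 mul0r add0r => ->; apply: near_mod1_int.
have [mj|jm] := leqP m j; rewrite /=.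
  exists 0; rewrite !subr0.
  apply: le_trans (horner_outside _ _ hQ) _.
  rewrite -!mulrA; apply: ler_wpM2l; first exact: coef_norm_ge0.
  by apply: lacunary_bound; apply: (ipsum_head _ _ _ _).2.
have [MA AS] := ipsum_head j J j a; have {}AS := AS (leqnn j).
rewrite (ipsum_cat (k := j)) ?Jj 1?ltnW // (ipsum_ltn _ jm) addnA.
have part A' : near_mod1 ((Q.[A'%:Z])%:~R * tau j)
      (if a j then (weight Q)%:~R / M%:R else 0)
      (coef_norm Q * csum * 2^-1 ^+ j) ->
    near_mod1 ((Q.[(A' + ipsum j.+1 m a)%:Z])%:~R * tau j)
      (if a j then (weight Q)%:~R / M%:R else 0)
      (coef_norm Q * csum * 2^-1 ^+ j).
  have [k ->] := horner_shift_tau Q A' (ipsum_dvd m a (ltnSn j)).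
  move=> h; rewrite -[X in near_mod1 _ _ X]addr0 -[X in near_mod1 _ X]addr0.
  by apply: near_mod1D h (near_mod1_int _ _).
apply: part; case: ifP => aj.
  apply: near_mod1_le (horner_inside j hQ MA).
  rewrite -!mulrA; apply: ler_wpM2l; first exact: coef_norm_ge0.
  exact: lacunary_bound.
exists 0; rewrite addn0 !subr0; apply: le_trans (horner_outside _ _ hQ) _.
rewrite -!mulrA; apply: ler_wpM2l; first exact: coef_norm_ge0.
exact: lacunary_bound.
Qed.

End RotationAngles.
(** * Limits along an idempotent ultrafilter *)

Section WeakOperatorLimits.
Variables (R : realType) (H : hilbertSpace R).
Local Notation C := R[i].

Lemma wot_plimP (p : set_system posnat) (T : posnat -> boundedOp H) S :
  ProperFilter p ->
  wot_plim p T S <-> forall x y (e : C), 0 < e ->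
    p [set n | `|hdot H (S x) y - hdot H (T n x) y| < e].
Proof.
move=> pp; pose f := @matrix_coefs R H.
have ptP (G : posnat -> {ptws H * H -> C^o}) g :
  (G @ p --> (g : {ptws H * H -> C^o})) <-> forall t, (fun n => G n t : C^o) @ p --> (g t : C^o).
  exact: pointwise_cvgP.
split.
  move=> cT x y e e0.
  have cf : (fun n => f (T n)) @ p --> (f S : {ptws H * H -> C^o}).
    apply: (cvg_comp _ _ cT).
    exact: (@initial_continuous _ _ f).
  have /cvgrPdist_lt /(_ e e0) := (ptP _ _).1 cf (x, y).
  exact.
move=> h.
have cf : (fun n => f (T n)) @ p --> (f S : {ptws H * H -> C^o}).
  apply/ptP => -[x y]; apply/cvgrPdist_lt => e e0; exact: h.
move=> A [_ [[B Bop <-] BS BA]].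
have pB : p [set n | B (f (T n))] := cf B (open_nbhs_nbhs (conj Bop BS)).
by rewrite /nbhs /= /nbhs /=; apply: filterS pB => n; apply: BA.
Qed.

End WeakOperatorLimits.

Section IPFilter.
Variables (n : nat -> nat).
Hypothesis n0 : forall j, (0 < n j)%N.

(** Sums over index sets beyond J that have at least J elements.  Long index sets
are what drives the matrix coefficients to 0. *)
Definition ip_block (J : nat) : set posnat :=
  [set k | exists m a, [/\ (J <= m)%N, (J <= block_size J m a)%N &
     val k = ipsum n J m a]].

Definition ip_filter : set_system posnat := [set A | exists J, ip_block J `<=` A].

Lemma ip_block_nonempty J : ip_block J !=set0.
Proof.
have p : (0 < ipsum n J (J + J).+1 xpredT)%N.
  rewrite /ipsum big_ltn ?ltnS ?leq_addr //.
  exact: leq_trans (n0 J) (leq_addr _ _).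
exists (exist (fun k => 0 < k)%N _ p), (J + J).+1, xpredT; split=> //.
  by rewrite leqW // leq_addr.
by rewrite /block_size sum_nat_const_nat muln1 -addnS addKn.
Qed.

Lemma restrict_sum (F : nat -> nat) (J J' m : nat) (a : pred nat) :
  (J <= J')%N -> (J' <= m)%N ->
  (\sum_(J <= j < m | (J' <= j)%N && a j) F j = \sum_(J' <= j < m | a j) F j)%N.
Proof.
move=> JJ J'm; rewrite (big_cat_nat _ (n := J')) //=.
rewrite [X in (X + _)%N]big_nat_cond big_pred0 ?add0n; last first.
  by move=> j; case: (ltnP j J') => h; rewrite ?andbF // andbF.
rewrite big_nat_cond [RHS]big_nat_cond; apply: eq_bigl => j.
by case: (leqP J' j).
Qed.

Lemma ip_block_le J J' : (J <= J')%N -> ip_block J' `<=` ip_block J.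
Proof.
move=> JJ k [m [a [J'm sz kE]]].
exists m, (fun j => (J' <= j)%N && a j); rewrite /block_size /ipsum !restrict_sum //.
by split=> //; [apply: leq_trans J'm|apply: leq_trans sz].
Qed.

Lemma ip_filter_proper : ProperFilter ip_filter.
Proof.
split; first by move=> [J hJ]; have [k /hJ] := ip_block_nonempty J.
split.
- by exists 0%N.
- move=> A B [J hA] [J' hB]; exists (maxn J J') => k hk; split.
    by apply: hA; apply: ip_block_le hk; apply: leq_maxl.
  by apply: hB; apply: ip_block_le hk; apply: leq_maxr.
- by move=> A B AB [J hA]; exists J; apply: subset_trans AB.
Qed.

Lemma splice_sum (F : nat -> nat) (J m m' : nat) (a a' : pred nat) :
  (J <= m)%N -> (m <= m')%N ->
  (\sum_(J <= j < m' | if j < m then a j else a' j) F j =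
   \sum_(J <= j < m | a j) F j + \sum_(m <= j < m' | a' j) F j)%N.
Proof.
move=> Jm mm; rewrite (big_cat_nat _ (n := m)) //=; congr (_ + _)%N.
  rewrite big_nat_cond [RHS]big_nat_cond; apply: eq_bigl => j.
  by case: (ltnP j m); rewrite ?andbF.
rewrite big_nat_cond [RHS]big_nat_cond; apply: eq_bigl => j.
by case: (ltnP j m); rewrite ?andbF.
Qed.

(** Adding to a sum over indices below m any sum over indices from m on gives the sum
over the union of the two sets. *)
Lemma ip_filter_add A : ip_filter A -> ultra_add ip_filter ip_filter A.
Proof.
move=> [J hA]; exists J => k [m [a [Jm sz kE]]]; exists m => k' [m' [a' [mm' sz' k'E]]].
apply: hA; exists m', (fun j => if (j < m)%N then a j else a' j).
rewrite /block_size /ipsum !splice_sum //; split.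
- exact: leq_trans mm'.
- by apply: leq_trans sz _; apply: leq_addr.
by rewrite /= kE k'E addnC.
Qed.

Lemma ip_idempotent : exists p, idempotent_ultrafilter p /\
  forall J, p (ip_block J).
Proof.
have ipp := ip_filter_proper.
have [p [pi ip]] := idempotent_extending ipp ip_filter_add.
by exists p; split=> // J; apply: ip; exists J.
Qed.

End IPFilter.
Section PhasePerturbation.
Variables (R : realType) (H : hilbertSpace R) (E : projFamily H).

Lemma phase_lim_near (t s r : nat -> R) (x : H) :
  summable_phase t -> summable_phase s -> summable_phase r ->
  (forall j, exists k : int, t j = s j + r j + k%:~R) ->
  `|phase_lim E t x - phase_lim E s x| <= (2 * pi * phase_norm r)%:C * `|x|.
Proof.
move=> st ss sr h; have ssr := summable_phaseD ss sr.
rewrite (phase_lim_int E (t := s \+ r)) // -(phase_limD E) //.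
rewrite -(phase_limB E) // phase_lim_norm //.
exact: phase_lim_le.
Qed.

End PhasePerturbation.

Section GeometricError.
Variable R : realType.

(** The induction carries the missing tail, so that the bound is uniform in the number
of terms. *)
Lemma geometric_tail (K : R) J (r : nat -> R) : 0 <= K ->
  (forall j, `|r j| <= if (J <= j)%N then K * 2^-1 ^+ j else 0) ->
  summable_phase r /\ phase_norm r <= K * 2 * 2^-1 ^+ J.
Proof.
move=> K0 h.
have bound n : \sum_(j < n) `|r j| + K * 2 * 2^-1 ^+ (maxn J n) <= K * 2 * 2^-1 ^+ J.
  elim: n => [|n IH]; first by rewrite big_ord0 add0r maxn0.
  apply: le_trans IH; rewrite big_ord_recr /= -addrA lerD2l.
  have := h n; case: (leqP J n) => [Jn|nJ] hn.
    by rewrite (maxn_idPr (leqW Jn)) exprS; lra.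
  by rewrite (maxn_idPl nJ) gerDr.
have bound' n : \sum_(j < n) `|r j| <= K * 2 * 2^-1 ^+ J.
  apply: le_trans (bound n); rewrite lerDl mulr_ge0 ?mulr_ge0 //.
  by rewrite exprn_ge0 // invr_ge0.
have sr : summable_phase r.
  apply: nondecreasing_is_cvgn.
    by apply/nondecreasing_seqP => n; rewrite seriesSr lerDl.
  by exists (K * 2 * 2^-1 ^+ J) => _ [k _ <-]; rewrite /series /= big_mkord bound'.
split=> //; apply: limr_le => //.
by near=> k; rewrite /series /= big_mkord bound'.
Unshelve. all: by end_near. Qed.

End GeometricError.

Section Rigidity.
Variables (R : realType) (N M : nat) (n : nat -> nat) (c : nat -> int).
Hypotheses (M0 : (0 < M)%N) (nlac : lacunary N M n) (c0 : c 0%N = 0).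
Local Notation C := R[i].
Local Notation H := (ell2_hilbert R).
Local Notation E := (eprojs R).
Local Notation "''[' x , y ]" := (hdot H x y).
Local Notation tau := (tau R N M n c).
Local Notation weight := (weight N c).

Lemma tau_summable : summable_phase tau.
Proof.
have [|sr _] := @geometric_tail R (csum R N c) 0 tau (csum_ge0 R N c) => // j /=.
apply: le_trans (tau_small R M0 nlac c0 j) _.
have := @lacunary_bound R N M n c nlac j 0 (leq0n _).
by rewrite addr0 expr1n mul1r.
Qed.

Definition rotU : unitaryOp H := phase_unitary E tau_summable.

Lemma rotU_pow Q (k : posnat) x :
  unitary_poly_pow rotU Q k x =
  phase_lim E (fun j => (Q.[(val k)%:Z])%:~R * tau j) x.
Proof. exact: phase_zpow. Qed.

Definition angle Q : R := (weight Q)%:~R / M%:R.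

(** U ^ Q(n_alpha) is, in norm, within O(2 ^ -J) of the operator whose angle is
weight Q / M on alpha and 0 elsewhere. *)
Lemma rotU_block Q : polyN N Q -> forall (x : H) (e : C), 0 < e ->
  exists J0, forall J m a k, (J0 <= J)%N -> (J <= m)%N ->
    val k = ipsum n J m a ->
    `|unitary_poly_pow rotU Q k x -
      phase_lim E (block_phase J m a (angle Q)) x| < e.
Proof.
move=> hQ x e e0.
have eE : e = (complex.Re e)%:C by rewrite RRe_real // gtr0_real.
move: (complex.Re e) eE => d eE; rewrite eE ltcR in e0.
have xE := norm_real x; move: (complex.Re `|x|) xE => r xE.
have r0 : 0 <= r by rewrite -lecR -xE normr_ge0.
pose K : R := coef_norm R N Q * csum R N c.
have K0 : 0 <= K by rewrite mulr_ge0 ?coef_norm_ge0 ?csum_ge0.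
pose B : R := 2 * pi * (K * 2) * r + 1.
have pi0 := pi_ge0 R.
have B0 : 0 < B.
  rewrite ltr_wpDl // (mulr_ge0 _ r0) // (mulr_ge0 (mulr_ge0 _ pi0)) //.
  by rewrite (mulr_ge0 K0).
have half1 : `|2^-1 : R| < 1 by rewrite ger0_norm ?invr_ge0 // invf_lt1 ?ltr1n.
have /cvgrPdist_lt /(_ (d / B)) := cvg_expr half1.
rewrite divr_gt0 // => /(_ isT) [J0 _ hJ0].
exists J0 => J m a k JJ Jm kE.
have hJ := hJ0 J JJ; rewrite /= sub0r normrN ger0_norm ?exprn_ge0 ?invr_ge0 // in hJ.
have /choice[z hz] := horner_ipsum R M0 nlac c0 a hQ Jm.
pose t j := (Q.[(val k)%:Z])%:~R * tau j.
pose s := block_phase J m a (angle Q).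
pose w j := t j - s j - (z j)%:~R.
have [sw nw] : summable_phase w /\ phase_norm w <= K * 2 * 2^-1 ^+ J.
  by apply: geometric_tail => // j; rewrite /w /t kE; apply: hz.
have st : summable_phase t by apply: summable_phaseZ tau_summable.
rewrite rotU_pow; apply: le_lt_trans (phase_lim_near E x st _ sw _) _.
- exact: block_phase_summable.
- by move=> j; exists (z j); change (t j = s j + w j + (z j)%:~R); rewrite /w; move: (t j) (s j) (z j)%:~R => u v e'; ring.
rewrite xE eE -rmorphM ltcR.
rewrite ltr_pdivlMr // in hJ; apply: le_lt_trans hJ.
apply: (@le_trans _ _ (2 * pi * (K * 2 * 2^-1 ^+ J) * r)).
  by rewrite ler_wpM2r // ler_wpM2l // mulr_ge0 // pi_ge0.
have J1 : 0 <= 2^-1 ^+ J :> R by rewrite exprn_ge0 // invr_ge0.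
rewrite (_ : _ * r = 2^-1 ^+ J * (2 * pi * (K * 2) * r)); last by ring.
by rewrite ler_wpM2l // lerDl.
Qed.

Variable p : set_system posnat.
Hypotheses (pid : idempotent_ultrafilter p) (pip : forall J, p (ip_block n J)).

Lemma rotU_rigid Q : polyN N Q -> (M%:Z %| weight Q)%Z ->
  wot_plim p (unitary_poly_pow rotU Q) (bop_id H).
Proof.
move=> hQ /dvdzP[k wE]; have pf := @ultra_proper _ _ pid.1.
apply/wot_plimP => x y e e0.
have y0 : 0 < `|y| + 1 by rewrite ltr_wpDl.
have [|J0 hJ0] := rotU_block hQ x (e := e / (`|y| + 1)).
  by rewrite divr_gt0.
apply: filterS (pip J0) => l [m [a [Jm _ lE]]] /=.
have := hJ0 J0 m a l (leqnn _) Jm lE.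
have -> : phase_lim E (block_phase J0 m a (angle Q)) x = x.
  rewrite (phase_lim_int E (t := fun=> 0)) ?phase_lim0 // => j.
  rewrite /block_phase; case: ifP => _; last by exists 0; rewrite addr0.
  exists k; rewrite /angle wE intrM add0r.
  by rewrite -pmulrn mulfK // pnatr_eq0 -lt0n.
rewrite ltr_pdivlMr // => h; rewrite -(@hdotBl R H).
apply: le_lt_trans (hdot_CS _ _) _; apply: le_lt_trans h.
by rewrite distrC ler_wpM2l // lerDl.
Qed.

Lemma rotU_mixing Q : polyN N Q -> ~~ (M%:Z %| weight Q)%Z ->
  wot_plim p (unitary_poly_pow rotU Q) (bop_zero H).
Proof.
move=> hQ nd; have pf := @ultra_proper _ _ pid.1.
apply/wot_plimP => x y e e0.
have w1 : circ (angle Q) != 1.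
  by apply: contra nd => /eqP; apply: circ_eq1.
have e2 : 0 < e / 2 by rewrite divr_gt0.
have y0 : 0 < `|y| + 1 by rewrite ltr_wpDl.
have [J1 hJ1] := block_phase_weak w1 x y e2.
have [|J0 hJ0] := rotU_block hQ x (e := e / 2 / (`|y| + 1)).
  by rewrite divr_gt0.
apply: filterS (pip (maxn J0 J1)) => l [m [a [Jm sz lE]]] /=.
have h0 := hJ0 _ m a l (leq_maxl _ _) Jm lE.
have h1 := hJ1 _ m a (leq_maxr _ _) Jm sz.
rewrite ltr_pdivlMr // in h0.
have -> : '[bop_zero H x, y] = 0.
  by rewrite -[LHS]/('[0, y]) -[0 in LHS](scale0r (0 : H)) (@hdotZl R H) mul0r.
rewrite sub0r normrN.
have {1}-> : unitary_poly_pow rotU Q l x =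
    (unitary_poly_pow rotU Q l x - phase_lim E (block_phase (maxn J0 J1) m a (angle Q)) x)
    + phase_lim E (block_phase (maxn J0 J1) m a (angle Q)) x by rewrite subrK.
rewrite (@hdotDl R H) [ltRHS](splitr e).
apply: le_lt_trans (ler_normD _ _) _; apply: ltrD => //.
apply: le_lt_trans (hdot_CS _ _) _; apply: le_lt_trans h0.
by rewrite ler_wpM2l // lerDl.
Qed.

End Rigidity.
Section PlimUnique.
Variables (R : realType) (H : hilbertSpace R).
Local Notation C := R[i].

Lemma wot_plim_id_zero (p : set_system posnat) (T : posnat -> boundedOp H) (x : H) :
  ProperFilter p -> wot_plim p T (bop_id H) -> wot_plim p T (bop_zero H) ->
  x = 0.
Proof.
move=> pp /wot_plimP h1 /wot_plimP h0; apply/eqP; apply: contraT => x0.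
have e0 : 0 < hdot H x x / 2 by rewrite divr_gt0 // -hdot_norm exprn_gt0 // normr_gt0.
have [n [/= hn1]] := filter_ex (filterI (h1 x x _ e0) (h0 x x _ e0)).
have -> : hdot H ((\0 : {linear H -> H}) x) x = 0.
  by rewrite -[LHS]/(hdot H 0 x) -[0 in LHS](scale0r (0 : H)) hdotZl mul0r.
rewrite sub0r normrN => hn0.
have := ler_normD (hdot H x x - hdot H (T n x) x) (hdot H (T n x) x).
rewrite subrK => /le_lt_trans /(_ (ltrD hn1 hn0)).
by rewrite -splitr ger0_norm ?ltxx // -hdot_norm exprn_ge0.
Qed.

Lemma ell2_nonzero : exists x : ell2_hilbert R, x != 0.
Proof.
have d : (fun k => if k == 0%N then 1 else 0 : C) \in @sqsummable R.
  by apply: (@finsupp_sqsummable _ _ 1) => -[|k].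
exists (Ell2 d); apply/eqP => /(congr1 (fun f : ell2 R => f 0%N)) /eqP.
by rewrite /= oner_eq0.
Qed.

End PlimUnique.

(** * The character that separates the polynomials *)

Section CharacterWeights.
Variables (N : nat) (P : 'I_N -> {poly int}).
Hypotheses (hP : forall i, polyN N (P i)) (hindep : poly_independent P).

(** Constant terms vanish, hence the shift by one in the degree. *)
Definition coef_mx : 'M[int]_N := \matrix_(i, d) (P i)`_d.+1.

(** A vector of the left kernel is a linear relation among the P_i. *)
Lemma det_coef_mx : \det coef_mx != 0.
Proof.
apply/negP => /det0P[v v0 vA]; case/eqP: v0; apply/rowP => i; rewrite mxE.
apply: (hindep (c := fun i => v 0 i)) => {i}.
apply/polyP => k; rewrite coef0 coef_sum.
have [kN|Nk] := ltnP k N.+1; last first.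
  apply: big1 => i _; rewrite coefZ nth_default ?mulr0 //.
  by apply: leq_trans Nk; case: (hP i).
case: k kN => [_|k kN].
  by apply: big1 => i _; rewrite coefZ -horner_coef0 (hP i).1 mulr0.
have := congr1 (fun w : 'rV_N => w 0 (Ordinal (kN : (k < N)%N))) vA; rewrite !mxE => e.
by rewrite -[RHS]e; apply: eq_bigr => i _; rewrite coefZ mxE.
Qed.

(** Let A be the matrix of coefficients, D its determinant and v the indicator of the
indices i >= s.  Then A (adj A v) = D v, so that the weights c = adj A v take the
values 0 or D, that is, 0 or half of M = 2 |D| modulo M. *)
Lemma separating_weights (s : nat) : exists (M : nat) (c : nat -> int),
  [/\ (0 < M)%N, c 0%N = 0 &
    forall i, (M%:Z %| weight N c (P i))%Z = (i < s)%N].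
Proof.
pose D := \det coef_mx.
have D0 : D != 0 := det_coef_mx.
pose v : 'cV[int]_N := \col_i (if (i < s)%N then 0 else 1).
pose w := \adj coef_mx *m v.
pose c k : int := if k is k'.+1 then
  (if insub k' is Some d then w d 0 else 0) else 0.
exists (2 * `|D|)%N, c; split=> //; first by rewrite muln_gt0 absz_gt0.
move=> i; have -> : weight N c (P i) = D * v i 0.
  rewrite /weight big_ord_recl /= mulr0 add0r.
  have := congr1 (fun u : 'cV_N => u i 0) (mulmxA coef_mx (\adj coef_mx) v).
  rewrite mul_mx_adj mul_scalar_mx [RHS]mxE => <-; rewrite [RHS]mxE.
  by apply: eq_bigr => d _; rewrite mxE /= valK.
rewrite mxE; case: ifP => _; first by rewrite mulr0 dvdz0.
rewrite mulr1 dvdzE /= -[X in (_ %| X)%N]mul1n dvdn_pmul2r ?absz_gt0 //.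
Qed.

End CharacterWeights.

Theorem corollaryF (R : realType) (N : nat) (hN : (0 < N)%N)
    (P : 'I_N -> {poly int}) (hP : forall i, polyN N (P i))
    (hindep : poly_independent P)
    (s : nat) (hs : (1 <= s <= N)%N) :
  (exists G : set {poly int},
     [/\ rigidity_group R N G,
         forall i : 'I_N, (i < s)%N -> G (P i)
       & forall i : 'I_N, (s <= i)%N -> ~ G (P i)]) /\
  (exists (H : hilbertSpace R) (U : unitaryOp H) (p : set_system posnat),
     [/\ exists x : H, x != 0,
         idempotent_ultrafilter p,
         forall i : 'I_N, (i < s)%N ->
           wot_plim p (unitary_poly_pow U (P i)) (bop_id H)
       & forall i : 'I_N, (s <= i)%N ->
           wot_plim p (unitary_poly_pow U (P i)) (bop_zero H)]).
Proof.
have [M [c [M0 c0 wP]]] := separating_weights hP hindep s.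
have [n nlac] := @lacunary_exists N M M0.
have n0 j : (0 < n j)%N by case: nlac.
have [p [pid pip]] := ip_idempotent n0.
have pf := @ultra_proper _ _ pid.1.
pose U := rotU R M0 nlac c0.
have rigid := @rotU_rigid R N M n c M0 nlac c0 p pid pip.
have mixing := @rotU_mixing R N M n c M0 nlac c0 p pid pip.
split; last first.
  exists (ell2_hilbert R), U, p; split=> //; first exact: ell2_nonzero.
    by move=> i si; apply: rigid; rewrite ?wP.
  by move=> i si; apply: mixing; rewrite ?wP -?leqNgt.
exists [set Q | polyN N Q /\ (M%:Z %| weight N c Q)%Z]; split; last 2 first.
- by move=> i si; split; rewrite ?wP.
- by move=> i si [_]; rewrite wP ltnNge si.
split.
  split; first by move=> Q [].
  split.
    rewrite inE; split; first by split; rewrite ?horner0 ?size_poly0.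
    by rewrite /weight big1 ?dvdz0 // => d _; rewrite coef0 mul0r.
  move=> Q Q'; rewrite !inE => -[[Q0 sQ] dQ] [[Q'0 sQ'] dQ']; split.
    split; first by rewrite hornerD hornerN Q0 Q'0 subrr.
    by rewrite (leq_trans (size_polyD _ _)) // size_polyN geq_max sQ.
  rewrite (_ : weight N c (Q - Q') = weight N c Q - weight N c Q').
    by rewrite rpredB.
  by rewrite /weight -sumrB; apply: eq_bigr => d _; rewrite coefB mulrBl.
exists (ell2_hilbert R), U, p; split=> //; first exact: ell2_nonzero.
  apply/seteqP; split=> Q /= [hQ]; first by move=> dQ; split=> //; apply: rigid.
  move=> lim1; split=> //; apply: contraT => nd.
  have [x /eqP x0] := ell2_nonzero R.
  by case: x0; apply: (wot_plim_id_zero x pf lim1); apply: mixing.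
move=> Q [hQ nQ]; apply: mixing => //; apply/negP => dQ; exact: nQ.
Qed.
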